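(* (a) Let $J$ be an indecomposable module in category $\mathcal{J}$, let $\lambda\in\mathbb{C}^n$ be a weight of $J$, and let $U=J_\lambda$ (a finite-dimensional space). Define $D_j(s)\in\mathrm{End}\,U$ by $D_j(s)u=e_{-s}(d_j(s)u)$. The operators $D_j(s)$ depend polynomially on $s$ and can be written uniquely as a finite sum $$D_j(s)=\lambda_j\,\mathrm{Id}+\sum_{\alpha\in\mathbb{Z}_+^n\setminus\{0\}}\frac{s^\alpha}{\alpha!}D_j^{(\alpha)},$$ with $D_j^{(\alpha)}\in\mathrm{End}\,U$ independent of $s$. Then $\rho\big(z^\alpha\frac{\partial}{\partial z_j}\big)=D_j^{(\alpha)}$ defines a finite-dimensional representation $\rho$ of $W_n^+$ on $U$. (b) For every finite-dimensional representation $\rho$ of $W_n^+$ on a space $U$, one has $\rho\big(z^\beta\frac{\partial}{\partial z_j}\big)=0$ for all but finitely many $\beta$. There is a one-to-one correspondence between indecomposable modules in category $\mathcal{J}$ and pairs $(\lambda,U)$, where $\lambda\in\mathbb{C}^n/\mathbb{Z}^n$ and $U$ is an indecomposable finite-dimensional $W_n^+$-module. To the pair $(\lambda,U)$ corresponds the module $J=\mathcal{F}(\mathbb{T}^n)\otimes U$, where $\mathcal{F}(\mathbb{T}^n)$ acts by multiplication on the first factor and $W_n$ acts by $$d_j(s)(e_m\otimes v)=(m_j+\lambda_j)\,e_{m+s}\otimes v+\sum_{\beta\in\mathbb{Z}_+^n\setminus\{0\}}\frac{s^\beta}{\beta!}\,e_{m+s}\otimes\rho\Big(z^\beta\frac{\partial}{\partial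 z_j}\Big)v .$$ Here $\lambda$ is any representative of its class. (c) There is a one-to-one correspondence between irreducible modules in category $\mathcal{J}$ and pairs $(\lambda,V)$, where $\lambda\in\mathbb{C}^n/\mathbb{Z}^n$ and $V$ is a finite-dimensional irreducible $\mathfrak{gl}_n(\mathbb{C})$-module. To the pair $(\lambda,V)$ corresponds the module $J=\mathcal{F}(\mathbb{T}^n)\otimes V$, where $\mathcal{F}(\mathbb{T}^n)$ acts by multiplication on the first factor and $W_n$ acts by $$d_j(s)(e_m\otimes v)=(m_j+\lambda_j)\,e_{m+s}\otimes v+\sum_{p=1}^n s_p\,e_{m+s}\otimes E^p_j v .$$
   Context: Let $n\ge 1$. Let $\mathcal{F}(\mathbb{T}^n)$ be the commutative algebra with $\mathbb{C}$-basis $e_m=e^{2\pi i m\cdot x}$, $m\in\mathbb{Z}^n$, and $e_me_k=e_{m+k}$. Let $W_n$ be the Lie algebra with $\mathbb{C}$-basis $d_j(s)=\frac{1}{2\pi i}e^{2\pi i s\cdot x}\frac{\partial}{\partial x^j}$, for $j=1,\dots,n$ and $s\in\mathbb{Z}^n$, and bracket $$[d_j(s),d_k(m)]=m_jd_k(s+m)-s_kd_j(s+m).$$ $W_n$ acts on $\mathcal{F}(\mathbb{T}^n)$ by derivations via $d_j(s)e_m=m_je_{m+s}$. Write $d_j=d_j(0)$. Category $\mathcal{J}$ consists of $W_n$-modules $J$ that are also $\mathcal{F}(\mathbb{T}^n)$-modules and satisfy: (J1) each $d_j$ acts diagonalizably on $J$; (J2) $J$ is a free $\mathcal{F}(\mathbb{T}^n)$-module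 of finite rank; (J3) $u(fw)=(uf)w+f(uw)$ for all $u\in W_n$, $f\in\mathcal{F}(\mathbb{T}^n)$, $w\in J$. Weight spaces are $J_\mu=\{w: d_jw=\mu_jw \text{ for all } j\}$. Submodules are invariant under both $W_n$ and $\mathcal{F}(\mathbb{T}^n)$. Indecomposable modules are nonzero. Correspondences are understood up to isomorphism. Notation: $\mathbb{Z}_+$ denotes the nonnegative integers, $\epsilon_j$ the standard basis of $\mathbb{Z}^n$, $s^\alpha=\prod_i s_i^{\alpha_i}$ and $\alpha!=\prod_i\alpha_i!$. $W_n^+$ is the Lie algebra of derivations of $\mathbb{C}[z_1,\dots,z_n]$ spanned by $z^\alpha\frac{\partial}{\partial z_j}$ with $\alpha\in\mathbb{Z}_+^n\setminus\{0\}$, $j=1,\dots,n$, with bracket $$\Big[z^\alpha\frac{\partial}{\partial z_j},z^\beta\frac{\partial}{\partial z_k}\Big]=\beta_jz^{\alpha+\beta-\epsilon_j}\frac{\partial}{\partial z_k}-\alpha_kz^{\alpha+\beta-\epsilon_k}\frac{\partial}{\partial z_j}.$$ $E^p_q\in\mathfrak{gl}_n(\mathbb{C})$ denotes the matrix with $1$ in position $(p,q)$ and $0$ elsewhere. *)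

(* Defs.v *)
(* Complex numbers are modelled as R[i] for R : realType; the definitions below are generic in a field C. *)
From HB Require Import structures.
From mathcomp Require Import all_boot all_algebra.
From mathcomp Require Import reals complex.
Set Implicit Arguments. Unset Strict Implicit. Unset Printing Implicit Defensive.
Import GRing.Theory.
Local Open Scope ring_scope.

Definition Zn (n : nat) := {ffun 'I_n -> int}.
Definition MI (n : nat) := {ffun 'I_n -> nat}.

Definition zadd n (m k : Zn n) : Zn n := [ffun i => m i + k i].
Definition zopp n (s : Zn n) : Zn n := [ffun i => - s i].
Definition z0 n : Zn n := [ffun _ => 0].

Definition mi0 n : MI n := [ffun _ => 0%N].
Definition miadd n (a b : MI n) : MI n := [ffun i => (a i + b i)%N].
(* alpha - eps_p (only used when alpha_p >= 1) *)
Definition misubeps n (a : MI n) (p : 'I_n) : MI n := [ffun i => (a i - (i == p))%N].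

Section Generic.
Variable C : fieldType.
Variable n : nat.

Definition spow (s : Zn n) (a : MI n) : C := \prod_(i < n) ((s i)%:~R ^+ a i).
Definition mifact (a : MI n) : nat := \prod_(i < n) (a i)`!.
Definition tcoef (s : Zn n) (a : MI n) : C := spow s a / (mifact a)%:R.

Definition is_subspace (V : lmodType C) (P : V -> Prop) :=
  [/\ P 0, (forall x y, P x -> P y -> P (x + y)) & (forall a x, P x -> P (a *: x))].

(* inv P : "P is invariant under the acting operators" *)
Definition indecomposable (V : lmodType C) (inv : (V -> Prop) -> Prop) :=
  (exists x : V, x <> 0) /\
  ~ (exists P Q : V -> Prop,
       [/\ is_subspace P, inv P, is_subspace Q & inv Q] /\
       [/\ (exists x, P x /\ x <> 0), (exists x, Q x /\ x <> 0),
           (forall x, P x -> Q x -> x = 0) &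
           (forall x, exists y z, [/\ P y, Q z & x = y + z])]).

Definition irreducible (V : lmodType C) (inv : (V -> Prop) -> Prop) :=
  (exists x : V, x <> 0) /\
  forall P : V -> Prop, is_subspace P -> inv P ->
    (forall x, P x -> x = 0) \/ (forall x, P x).

Record WFmod := {
  wf_car : lmodType C;
  wf_d : 'I_n -> Zn n -> {linear wf_car -> wf_car};
  wf_e : Zn n -> {linear wf_car -> wf_car} }.

Definition WF_inv (M : WFmod) (P : wf_car M -> Prop) :=
  (forall j s x, P x -> P (wf_d M j s x)) /\ (forall m x, P x -> P (wf_e M m x)).

Definition is_WFmod (M : WFmod) :=
  [/\ (forall j k (s m : Zn n) x,
         wf_d M j s (wf_d M k m x) - wf_d M k m (wf_d M j s x)
         = (m j)%:~R *: wf_d M k (zadd s m) x - (s k)%:~R *: wf_d M j (zadd s m) x),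
      (forall x, wf_e M (z0 n) x = x) &
      (forall m k x, wf_e M m (wf_e M k x) = wf_e M (zadd m k) x)].

Definition dj (M : WFmod) (j : 'I_n) := wf_d M j (z0 n).

Definition J1 (M : WFmod) :=
  forall j (x : wf_car M), exists (S : seq C) (xs : C -> wf_car M),
    x = \sum_(mu <- S) xs mu /\ (forall mu, mu \in S -> dj M j (xs mu) = mu *: xs mu).

Definition J2 (M : WFmod) :=
  exists (r : nat) (b : 'I_r -> wf_car M),
    (forall x, exists (S : seq (Zn n)) (c : 'I_r -> Zn n -> C),
        x = \sum_(i < r) \sum_(m <- S) c i m *: wf_e M m (b i)) /\
    (forall (S : seq (Zn n)) (c : 'I_r -> Zn n -> C), uniq S ->
        \sum_(i < r) \sum_(m <- S) c i m *: wf_e M m (b i) = 0 ->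
        forall i m, m \in S -> c i m = 0).

Definition J3 (M : WFmod) :=
  forall j s m x, wf_d M j s (wf_e M m x)
                  = (m j)%:~R *: wf_e M (zadd m s) x + wf_e M m (wf_d M j s x).

Definition in_catJ (M : WFmod) := [/\ is_WFmod M, J1 M, J2 M & J3 M].

Definition WF_indecomposable (M : WFmod) := indecomposable (@WF_inv M).
Definition WF_irreducible (M : WFmod) := irreducible (@WF_inv M).

Definition WF_iso (M N : WFmod) :=
  exists f : {linear wf_car M -> wf_car N}, bijective f /\
    (forall j s x, f (wf_d M j s x) = wf_d N j s (f x)) /\
    (forall m x, f (wf_e M m x) = wf_e N m (f x)).

Definition in_weight (M : WFmod) (lam : 'I_n -> C) (x : wf_car M) :=
  forall j, dj M j x = lam j *: x.

Definition same_class (lam lam' : 'I_n -> C) :=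
  exists k : Zn n, forall j, lam' j = lam j + (k j)%:~R.

(* wp_rho j alpha = rho(z^alpha d/dz_j); only alpha <> 0 is meaningful *)
Record WPmod := {
  wp_car : vectType C;
  wp_rho : 'I_n -> MI n -> {linear wp_car -> wp_car} }.

Definition is_WPrep (U : WPmod) :=
  forall j k (a b : MI n) v, a <> mi0 n -> b <> mi0 n ->
    wp_rho U j a (wp_rho U k b v) - wp_rho U k b (wp_rho U j a v)
    = (b j)%:R *: wp_rho U k (misubeps (miadd a b) j) v
      - (a k)%:R *: wp_rho U j (misubeps (miadd a b) k) v.

Definition WP_inv (U : WPmod) (P : wp_car U -> Prop) :=
  forall j a x, a <> mi0 n -> P x -> P (wp_rho U j a x).

Definition WP_indecomposable (U : WPmod) := indecomposable (@WP_inv U).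

Definition WP_iso (U U' : WPmod) :=
  exists f : {linear wp_car U -> wp_car U'}, bijective f /\
    forall j a v, a <> mi0 n -> f (wp_rho U j a v) = wp_rho U' j a (f v).

Definition supp_list (U : WPmod) (B : seq (MI n)) :=
  [/\ uniq B, mi0 n \notin B &
      forall j b, b <> mi0 n -> b \notin B -> forall v, wp_rho U j b v = 0].

(* "J is (isomorphic to) F(T^n) (x) U with the given action":
   iota m v stands for e_m (x) v. *)
Definition tensor_decomp (M : WFmod) (V : lmodType C)
    (iota : Zn n -> {linear V -> wf_car M}) :=
  (forall x, exists (S : seq (Zn n)) (v : Zn n -> V), x = \sum_(m <- S) iota m (v m)) /\
  (forall (S : seq (Zn n)) (v : Zn n -> V), uniq S ->
     \sum_(m <- S) iota m (v m) = 0 -> forall m, m \in S -> v m = 0) /\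
  (forall k m w, wf_e M k (iota m w) = iota (zadd m k) w).

Definition realizes_WP (M : WFmod) (lam : 'I_n -> C) (U : WPmod) :=
  exists iota : Zn n -> {linear wp_car U -> wf_car M},
    tensor_decomp iota /\
    exists B, supp_list U B /\
      forall j s m v,
        wf_d M j s (iota m v)
        = ((m j)%:~R + lam j) *: iota (zadd m s) v
          + \sum_(b <- B) tcoef s b *: iota (zadd m s) (wp_rho U j b v).

Record GLmod := {
  gl_car : vectType C;
  gl_E : 'I_n -> 'I_n -> {linear gl_car -> gl_car} }.

Definition is_GLrep (V : GLmod) :=
  forall p q r t v,
    gl_E V p q (gl_E V r t v) - gl_E V r t (gl_E V p q v)
    = (q == r)%:R *: gl_E V p t v - (t == p)%:R *: gl_E V r q v.

Definition GL_inv (V : GLmod) (P : gl_car V -> Prop) :=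
  forall p q x, P x -> P (gl_E V p q x).

Definition GL_irreducible (V : GLmod) := irreducible (@GL_inv V).

Definition GL_iso (V V' : GLmod) :=
  exists f : {linear gl_car V -> gl_car V'}, bijective f /\
    forall p q v, f (gl_E V p q v) = gl_E V' p q (f v).

Definition realizes_GL (M : WFmod) (lam : 'I_n -> C) (V : GLmod) :=
  exists iota : Zn n -> {linear gl_car V -> wf_car M},
    tensor_decomp iota /\
    forall j s m v,
      wf_d M j s (iota m v)
      = ((m j)%:~R + lam j) *: iota (zadd m s) v
        + \sum_(p < n) (s p)%:~R *: iota (zadd m s) (gl_E V p j v).

Definition extD (M : WFmod) (A : seq (MI n)) (D : 'I_n -> MI n -> wf_car M -> wf_car M)
  j a x := if a \in A then D j a x else 0.

Definition D_expansion (M : WFmod) (lam : 'I_n -> C) (A : seq (MI n))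
   (D : 'I_n -> MI n -> wf_car M -> wf_car M) :=
  [/\ uniq A, mi0 n \notin A &
      forall j s u, in_weight lam u ->
        wf_e M (zopp s) (wf_d M j s u) = lam j *: u + \sum_(a <- A) tcoef s a *: D j a u].

End Generic.

(* Main.v *)
(* On a weight space U of J put D_j(s) = e_{-s} d_j(s). Since J = F(T^n) (x) U,
   the W_n-action is equivalent to the commutation relations [jetlaw] of these
   operators, submodules of J correspond to D-invariant subspaces of U, and
   isomorphisms of modules to intertwiners of the D's together with a shift of
   the weight. The relations say that D represents the vector fields on the
   torus vanishing at the unit point. The bracket with D_i(-eps_i) acts on the
   iterated i-th differences of D_k at suitable points by pairwise distinct
   scalars, so finite dimensionality of End U kills the differences of high
   order and D_k(s) is polynomial in s. Comparing Taylor coefficients turns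
   [jetlaw] into the commutation relations of W_n^+ and back. In a finite
   dimensional W_n^+-module the Euler field has finitely many eigenvalues, which
   makes z^a d/dz_j act by zero for large |a|, and for all |a| >= 2 if the module
   is irreducible. *)
Require Import Defs.
From HB Require Import structures.
From mathcomp Require Import all_boot all_order all_algebra.
From mathcomp Require Import reals complex.
From mathcomp Require Import boolp functions.
From mathcomp Require Import ring zify.
Set Implicit Arguments. Unset Strict Implicit. Unset Printing Implicit Defensive.
Import Order.TTheory GRing.Theory Num.Theory VectorInternalTheory.
Local Open Scope ring_scope.

(** * Direct decompositions *)

(** In the proof [D j s] is e_{-s} d_j(s) with the scalar lam_j removed. Writing q^s for e_s, it
    stands for the vector field (q^s - 1) q_j d/dq_j, and [jetlaw] is the bracket of these fields.
    Removing lam_j makes lam disappear from the relations, so lam and U can be chosen independently.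
    With q = e^z the field becomes the sum over nonzero alpha of s^alpha / alpha! z^alpha d/dz_j,
    which is why Taylor coefficients of [D] obey the relations of W_n^+. One obstacle is that [D] is
    a mere function on Z^n. Newton interpolation, one coordinate at a time, needs an order of
    vanishing differences that is uniform in the other coordinates; it is uniform because it depends
    only on the spectrum of one operator, the bracket with D_i(-eps_i). Another is that the basis
    given by freeness need not consist of weight vectors, so a weight space has to be compared with
    C^r. *)

Section Subspaces.
Variables (C : fieldType) (V : lmodType C) (P : V -> Prop).
Hypothesis subP : is_subspace P.

Lemma subspace0 : P 0. Proof. by case: subP. Qed.

Lemma subspaceD x y : P x -> P y -> P (x + y).
Proof. by case: subP => _ + _; apply. Qed.

Lemma subspaceZ a x : P x -> P (a *: x).
Proof. by case: subP => _ _; apply. Qed.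

Lemma subspaceN x : P x -> P (- x).
Proof. by rewrite -scaleN1r; apply: subspaceZ. Qed.

Lemma subspaceB x y : P x -> P y -> P (x - y).
Proof. by move=> Px Py; apply/subspaceD/subspaceN. Qed.

Lemma subspaceZK a x : a != 0 -> P (a *: x) -> P x.
Proof. by move=> a0 /(subspaceZ a^-1); rewrite scalerA mulVf // scale1r. Qed.

Lemma subspace_sum (I : eqType) (S : seq I) (F : I -> V) :
  (forall i, i \in S -> P (F i)) -> P (\sum_(i <- S) F i).
Proof.
move=> PF; rewrite big_seq; elim/big_ind: _ => //; first exact: subspace0.
exact: subspaceD.
Qed.

End Subspaces.

Lemma subspace_eq0 (C : fieldType) (V : lmodType C) :
  is_subspace (fun x : V => x = 0).
Proof. by split=> // [x y -> ->|a x ->]; rewrite ?addr0 ?scaler0. Qed.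

(* The induction of the Dedekind-Artin proof of independence of characters. *)
Lemma joint_eigen_sum (C : fieldType) (V : lmodType C) (K : eqType) (I : Type)
    (T : I -> {linear V -> V}) (chi : K -> I -> C) (P : V -> Prop) :
  (forall k k', k != k' -> exists t, chi k t != chi k' t) ->
  is_subspace P -> (forall t x, P x -> P (T t x)) ->
  forall (S : seq K) (x : K -> V), uniq S ->
  (forall k t, k \in S -> T t (x k) = chi k t *: x k) ->
  P (\sum_(k <- S) x k) -> forall k, k \in S -> P (x k).
Proof.
move=> sep subP TP; elim=> [//|k0 S IH] x /= /andP[k0S uS] Tx.
rewrite big_cons => Psum.
have PS k : k \in S -> P (x k).
  move=> kS; have [t kt] : exists t, chi k t != chi k0 t.
    by apply: sep; apply: contraNneq k0S => <-.
  apply: (subspaceZK subP (a := chi k t - chi k0 t)); first by rewrite subr_eq0.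
  apply: (IH (fun l => (chi l t - chi k0 t) *: x l)) kS => //.
    move=> l t' lS; rewrite linearZ /= Tx ?in_cons ?lS ?orbT // !scalerA.
    by rewrite mulrC.
  have := subspaceB subP (TP t _ Psum) (subspaceZ subP (chi k0 t) Psum).
  rewrite linearD linear_sum /= Tx ?mem_head // scalerDr opprD addrACA subrr.
  rewrite add0r scaler_sumr -sumrB; congr P.
  rewrite !big_seq; apply: eq_bigr => l lS.
  by rewrite Tx ?in_cons ?lS ?orbT // scalerBl.
move=> k; rewrite in_cons => /predU1P[->|]; last exact: PS.
have := subspaceB subP Psum (subspace_sum subP (F := x) PS).
by rewrite addrK.
Qed.

Lemma eigen_sum (C : fieldType) (V : lmodType C) (f : {linear V -> V})
    (P : V -> Prop) (S : seq C) (x : C -> V) :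
  is_subspace P -> (forall y, P y -> P (f y)) -> uniq S ->
  (forall c, c \in S -> f (x c) = c *: x c) ->
  P (\sum_(c <- S) x c) -> forall c, c \in S -> P (x c).
Proof.
move=> subP fP uS fx Psum.
apply: (joint_eigen_sum (T := fun _ : unit => f) (chi := fun c _ => c) _ subP _ uS) => //.
by move=> k [] /fx.
Qed.

(** Finitely supported sums run over explicit lists; this exchanges two lists that differ only where
    the terms vanish. *)
Lemma eq_sum_supp (V : nmodType) (K : eqType) (A B : seq K) (F : K -> V) :
  uniq A -> uniq B ->
  (forall k, k \in A -> k \notin B -> F k = 0) ->
  (forall k, k \in B -> k \notin A -> F k = 0) ->
  \sum_(k <- A) F k = \sum_(k <- B) F k.
Proof.
move=> uA uB FA FB.
have sub (A' B' : seq K) : (forall k, k \in A' -> k \notin B' -> F k = 0) ->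
    \sum_(k <- A') F k = \sum_(k <- [seq k <- A' | k \in B']) F k.
  move=> F0; rewrite big_filter [RHS]big_mkcond /= !big_seq.
  by apply: eq_bigr => k kA; case: ifPn => // /F0; apply.
rewrite (sub _ _ FA) (sub _ _ FB); apply: perm_big.
apply: uniq_perm; rewrite ?filter_uniq // => k.
by rewrite !mem_filter andbC.
Qed.

(** Spanning hypotheses provide lists with possible repetitions, independence wants duplicate-free
    ones; multiplicities are absorbed into scalars. *)
Lemma sum_undup (C : pzRingType) (V : lmodType C) (K : eqType) (S : seq K)
    (F : K -> V) :
  \sum_(k <- S) F k = \sum_(k <- undup S) (count_mem k S)%:R *: F k.
Proof.
under [RHS]eq_bigr do rewrite scaler_nat.
elim: S => [|k S IH] /=; first by rewrite !big_nil.
rewrite big_cons IH; case: ifPn => kS.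
  rewrite (bigD1_seq k) ?undup_uniq ?mem_undup //=.
  rewrite [RHS](bigD1_seq k) ?undup_uniq ?mem_undup //= eqxx mulrS -addrA.
  congr (_ + (_ + _)); apply: eq_bigr => l.
  by rewrite eq_sym => /negPf ->.
rewrite big_cons eqxx (count_memPn kS) addn0 mulr1n; congr (_ + _).
rewrite !big_seq; apply: eq_bigr => l; rewrite mem_undup => lS.
by case: eqP => // kl; rewrite kl lS in kS.
Qed.

(** Internal direct sum of the images of the [G k]. It serves for tensor decompositions ([G k]
    everything) and for weight decompositions ([iota] the identity, [G k] a weight space). *)
Definition decomp (C : fieldType) (K : eqType) (W M : lmodType C)
    (G : K -> W -> Prop) (iota : K -> {linear W -> M}) :=
  [/\ (forall k, is_subspace (G k)),
      (forall x, exists (S : seq K) (v : K -> W),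
         (forall k, G k (v k)) /\ x = \sum_(k <- S) iota k (v k)) &
      (forall (S : seq K) (v : K -> W), uniq S -> (forall k, G k (v k)) ->
         \sum_(k <- S) iota k (v k) = 0 -> forall k, k \in S -> v k = 0)].

Section Spanned.
Variables (C : fieldType) (K : eqType) (W M : lmodType C).
Variables (G : K -> W -> Prop) (iota : K -> {linear W -> M}).
Hypothesis subG : forall k, is_subspace (G k).

Definition spanned x := exists (S : seq K) (v : K -> W),
  (forall k, G k (v k)) /\ x = \sum_(k <- S) iota k (v k).

Lemma spanned_uniq x : spanned x -> exists (S : seq K) (v : K -> W),
  [/\ uniq S, (forall k, G k (v k)), (forall k, k \notin S -> v k = 0) &
      x = \sum_(k <- S) iota k (v k)].
Proof.
move=> [S [v [Gv ->]]].
exists (undup S), (fun k => if k \in S then (count_mem k S)%:R *: v k else 0).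
split=> [|k|k|]; first exact: undup_uniq.
- by case: ifP => _; [apply: subspaceZ|apply: subspace0].
- by rewrite mem_undup; case: ifP.
- rewrite sum_undup !big_seq; apply: eq_bigr => k; rewrite mem_undup => ->.
  by rewrite linearZ.
Qed.

Lemma spanned_mem k w : G k w -> spanned (iota k w).
Proof.
move=> Gw; exists [:: k], (fun l => if l == k then w else 0).
rewrite big_seq1 eqxx; split=> // l; case: eqP => [->//|_].
exact: subspace0.
Qed.

Lemma spanned_subspace : is_subspace spanned.
Proof.
split=> [|x y|a x].
- by exists [::], (fun=> 0); rewrite big_nil; split=> // k; apply: subspace0.
- move=> /spanned_uniq[S [v [uS Gv vS ->]]] /spanned_uniq[S' [v' [uS' Gv' vS' ->]]].
  have ext A w : uniq A -> (forall k, k \notin A -> w k = 0) ->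
      {subset A <= undup (S ++ S')} ->
      \sum_(k <- A) iota k (w k) = \sum_(k <- undup (S ++ S')) iota k (w k).
    move=> uA wA AS; apply: eq_sum_supp; rewrite ?undup_uniq //.
      by move=> k /AS ->.
    by move=> k _ /wA ->; rewrite linear0.
  exists (undup (S ++ S')), (fun k => v k + v' k); split.
    by move=> k; apply: subspaceD.
  rewrite (ext S v) // ?(ext S' v') // -?big_split.
  + by apply: eq_bigr => k _; rewrite linearD.
  + by move=> k kS; rewrite mem_undup mem_cat kS orbT.
  + by move=> k kS; rewrite mem_undup mem_cat kS.
- move=> [S [v [Gv ->]]]; exists S, (fun k => a *: v k); split.
    by move=> k; apply: subspaceZ.
  by rewrite scaler_sumr; apply: eq_bigr => k _; rewrite linearZ.
Qed.

End Spanned.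

Section Decomp.
Variables (C : fieldType) (K : eqType) (W M : lmodType C).
Variables (G : K -> W -> Prop) (iota : K -> {linear W -> M}).
Hypothesis dec : decomp G iota.

Lemma decomp_uniq x : exists (S : seq K) (v : K -> W),
  [/\ uniq S, (forall k, G k (v k)), (forall k, k \notin S -> v k = 0) &
      x = \sum_(k <- S) iota k (v k)].
Proof.
by case: dec => subG span _; apply: (spanned_uniq subG (span x)).
Qed.

Variable N : lmodType C.

Lemma decomp_ext (f g : {linear M -> N}) :
  (forall k w, G k w -> f (iota k w) = g (iota k w)) -> f =1 g.
Proof.
move=> fg x; have [S [v [_ Gv _ ->]]] := decomp_uniq x.
by rewrite !linear_sum; apply: eq_bigr => k _; apply: fg.
Qed.

(** Universal property of the direct sum. The map is obtained from its graph [R], since a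
    representation of x as a sum is not canonical; [R] is linear and relates 0 only to 0, hence is
    single-valued. *)
Lemma decomp_lift (g : K -> {linear W -> N}) :
  exists f : {linear M -> N}, forall k w, G k w -> f (iota k w) = g k w.
Proof.
pose R x y := exists (S : seq K) (v : K -> W),
  [/\ uniq S, (forall k, G k (v k)), (forall k, k \notin S -> v k = 0),
      x = \sum_(k <- S) iota k (v k) & y = \sum_(k <- S) g k (v k)].
have Rlin a x y x' y' : R x y -> R x' y' -> R (a *: x + x') (a *: y + y').
  move=> [S [v [uS Gv vS -> ->]]] [S' [v' [uS' Gv' vS' -> ->]]].
  have ext (L : lmodType C) (h : K -> {linear W -> L}) A w :
      uniq A -> (forall k, k \notin A -> w k = 0) ->
      {subset A <= undup (S ++ S')} ->
      \sum_(k <- A) h k (w k) = \sum_(k <- undup (S ++ S')) h k (w k).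
    move=> uA wA AS; apply: eq_sum_supp; rewrite ?undup_uniq //.
      by move=> k /AS ->.
    by move=> k _ /wA ->; rewrite linear0.
  exists (undup (S ++ S')), (fun k => a *: v k + v' k).
  have sub1 : {subset S <= undup (S ++ S')}.
    by move=> k kS; rewrite mem_undup mem_cat kS.
  have sub2 : {subset S' <= undup (S ++ S')}.
    by move=> k kS; rewrite mem_undup mem_cat kS orbT.
  split; first exact: undup_uniq.
  - move=> k; case: dec => sG _ _; apply: (subspaceD (sG k)) (Gv' k).
    exact: subspaceZ (sG k) _ _ (Gv k).
  - move=> k kSS; rewrite vS ?vS' ?scaler0 ?addr0 //.
      by apply: contra kSS => /sub2.
    by apply: contra kSS => /sub1.
  - rewrite (ext _ iota S v) // (ext _ iota S' v') // scaler_sumr -big_split.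
    by apply: eq_bigr => k _; rewrite linearP.
  - rewrite (ext _ g S v) // (ext _ g S' v') // scaler_sumr -big_split.
    by apply: eq_bigr => k _; rewrite linearP.
have R0 y : R 0 y -> y = 0.
  move=> [S [v [uS Gv vS x0 ->]]]; rewrite big_seq big1 // => k kS.
  case: dec => _ _ /(_ S v uS Gv (esym x0) k kS) ->; exact: linear0.
have Rfun x y y' : R x y -> R x y' -> y = y'.
  move=> Ry Ry'; have := Rlin (-1) _ _ _ _ Ry Ry'.
  by rewrite !scaleN1r addNr => /R0 /eqP; rewrite addrC subr_eq0 => /eqP.
have Rex x : exists y, R x y.
  have [S [v [uS Gv vS ->]]] := decomp_uniq x.
  by exists (\sum_(k <- S) g k (v k)), S, v.
pose h x := sval (cid (Rex x)); have Rh x : R x (h x) by exact: svalP.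
have hlin : linear h.
  by move=> a x y; apply: Rfun (Rh _) _; apply: Rlin.
pose hL := GRing.isLinear.Build C M N *:%R h hlin.
pose f : {linear M -> N} := HB.pack h hL.
exists f => k w Gw; apply: Rfun (Rh _) _.
exists [:: k], (fun l => if l == k then w else 0); split=> //.
- by move=> l; case: eqP => [->//|_]; case: dec => /(_ l) /subspace0.
- by move=> l; rewrite inE => /negPf ->.
- by rewrite big_seq1 eqxx.
- by rewrite big_seq1 eqxx.
Qed.

End Decomp.

(** * Modules of the form F(T^n) (x) U *)

Lemma zaddE n (m k : Zn n) : zadd m k = m + k.
Proof. by apply/ffunP => i; rewrite !ffunE. Qed.

Lemma z0E n : z0 n = 0.
Proof. by apply/ffunP => i; rewrite !ffunE. Qed.

Lemma zoppE n (m : Zn n) : zopp m = - m.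
Proof. by apply/ffunP => i; rewrite !ffunE. Qed.

Definition znE := (zaddE, z0E, zoppE).

Definition mk_linear (C : pzRingType) (V W : lmodType C) (f : V -> W)
    (fl : linear f) : {linear V -> W} :=
  let fL := GRing.isLinear.Build C V W *:%R f fl in HB.pack f fL.

Lemma v2r_ext (C : fieldType) (U : vectType C) (x y : U) :
  (forall i, v2r x 0 i = v2r y 0 i) -> x = y.
Proof. by move=> xy; apply/(can_inj v2rK)/rowP. Qed.

Ltac module_eq :=
  apply: v2r_ext => ?; rewrite !(linearD, linearN, linearZ, linear0) /= !mxE; ring.

(** The condition [D j 0 = 0] fixes how d_j(0) is divided between lam_j and [D]: it says that
    [iota m] lands in the weight space of weight lam + m. *)
Definition coords (C : fieldType) n (M : WFmod C n) (lam : 'I_n -> C)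
    (U : vectType C) (iota : Zn n -> {linear U -> wf_car M})
    (D : 'I_n -> Zn n -> 'End(U)) :=
  [/\ tensor_decomp iota, (forall j, D j 0 = 0) &
      forall j s m v, wf_d M j s (iota m v)
        = iota (m + s) (((m j)%:~R + lam j) *: v + D j s v)].

Definition jetlaw (C : fieldType) n (U : vectType C) (D : 'I_n -> Zn n -> 'End(U)) :=
  forall j k (s m : Zn n) v,
    D j s (D k m v) - D k m (D j s v)
    = (m j)%:~R *: (D k (s + m) v - D k m v)
      - (s k)%:~R *: (D j (s + m) v - D j s v).

Section Tensor.
Variables (C : fieldType) (n : nat) (M : WFmod C n) (U : lmodType C).
Variable iota : Zn n -> {linear U -> wf_car M}.
Hypothesis dec : tensor_decomp iota.

Lemma tensor_dec : decomp (fun _ _ => True) iota.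
Proof.
case: dec => span [indep _]; split=> //.
  by move=> x; have [S [v ->]] := span x; exists S, v.
by move=> S v uS _; apply: indep.
Qed.

Lemma tensor_e k m w : wf_e M k (iota m w) = iota (m + k) w.
Proof. by case: dec => _ [_ ->]; rewrite zaddE. Qed.

Lemma tensor_ext (N : lmodType C) (f g : {linear wf_car M -> N}) :
  (forall m w, f (iota m w) = g (iota m w)) -> f =1 g.
Proof. by move=> fg; apply: (decomp_ext tensor_dec) => m w _. Qed.

Lemma tensor_lift (N : lmodType C) (g : Zn n -> {linear U -> N}) :
  exists f : {linear wf_car M -> N}, forall m w, f (iota m w) = g m w.
Proof.
by have [f fg] := decomp_lift tensor_dec g; exists f => m w; apply: fg.
Qed.

Lemma tensor_proj : exists pr : Zn n -> {linear wf_car M -> U},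
  (forall m k w, pr m (iota k w) = if k == m then w else 0) /\
  (forall x, exists2 S, uniq S & x = \sum_(m <- S) iota m (pr m x)).
Proof.
have ex m : exists f : {linear wf_car M -> U},
    forall k w, f (iota k w) = if k == m then w else 0.
  have [f fE] := @tensor_lift U
    (fun k => if k == m then [the {linear U -> U} of idfun] else [the {linear U -> U} of \0%R]).
  by exists f => k w; rewrite fE; case: eqP.
exists (fun m => sval (cid (ex m))).
have prE m k w : sval (cid (ex m)) (iota k w) = if k == m then w else 0.
  exact: (svalP (cid (ex m))).
split=> // x; have [S [v [uS _ vS ->]]] := decomp_uniq tensor_dec x.
exists S => //; apply: eq_big_seq => m mS.
rewrite linear_sum /= (bigD1_seq m) //= prE eqxx big1 ?addr0 // => k /negPf km.
by rewrite prE km.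
Qed.

Lemma iota_inj m : injective (iota m).
Proof.
move=> x y xy; have [pr [prE _]] := tensor_proj.
by have := prE m m y; rewrite -xy prE eqxx.
Qed.

End Tensor.

Lemma sum_fibers (V : nmodType) (K : eqType) (L : eqType) (S : seq K) (h : K -> L)
    (F : K -> V) :
  \sum_(k <- S) F k = \sum_(l <- undup (map h S)) \sum_(k <- S | h k == l) F k.
Proof.
rewrite (exchange_big_dep xpredT) //=; apply: eq_big_seq => k kS.
rewrite big_mkcond (bigD1_seq (h k)) /= ?undup_uniq ?mem_undup ?map_f ?eqxx //.
by rewrite big1 ?addr0 // => l; rewrite eq_sym => /negPf ->.
Qed.

Lemma tensor_J2 (C : fieldType) n (M : WFmod C n) (U : vectType C)
    (iota : Zn n -> {linear U -> wf_car M}) : tensor_decomp iota -> J2 M.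
Proof.
move=> dec; pose b i := iota 0 (r2v (delta_mx 0 i)).
have eb m i : wf_e M m (b i) = iota m (r2v (delta_mx 0 i)).
  by rewrite /b (tensor_e dec) add0r.
have r2v_sum (c : 'rV[C]_(dim U)) : r2v c = \sum_i c 0 i *: r2v (delta_mx 0 i) :> U.
  by rewrite {1}(row_sum_delta c) linear_sum; apply: eq_bigr => i _; rewrite linearZ.
exists (dim U), b; split=> [x|S c uS].
  have [S [v [_ _ _ ->]]] := decomp_uniq (tensor_dec dec) x.
  exists S, (fun i m => v2r (v m) 0 i); rewrite exchange_big; apply: eq_bigr => m _.
  rewrite -{1}(v2rK (v m)) r2v_sum linear_sum.
  by apply: eq_bigr => i _; rewrite !linearZ /= eb.
rewrite exchange_big => /= S0 i m mS.
pose v m := r2v (\row_i c i m) : U.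
have /(_ S v uS) H := dec.2.1; have {}H := H _ m mS.
suff /H vm0 : \sum_(m <- S) iota m (v m) = 0.
  by have := congr1 (fun x => v2r x 0 i) vm0; rewrite /v r2vK linear0 !mxE.
rewrite -[RHS]S0; apply: eq_bigr => k _; rewrite /v r2v_sum.
by rewrite linear_sum; apply: eq_bigr => l _; rewrite mxE !linearZ /= eb.
Qed.

(** A basis of r elements identifies M with F(T^n) (x) C^r over F(T^n) only; its elements need not
    be weight vectors, so this is not yet the form [coords]. *)
Lemma J2_tensor (C : fieldType) n (M : WFmod C n) : is_WFmod M -> J2 M ->
  exists r (iota : Zn n -> {linear 'rV[C]_r -> wf_car M}), tensor_decomp iota.
Proof.
move=> [_ _ eM] [r [b [span indep]]].
have blin : linear (fun v : 'rV[C]_r => \sum_i v 0 i *: b i).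
  move=> a x y; rewrite scaler_sumr -big_split; apply: eq_bigr => i _.
  by rewrite !mxE scalerDl scalerA.
pose phi := mk_linear blin.
exists r, (fun m => [the {linear _ -> _} of wf_e M m \o phi]).
have sumE (S : seq (Zn n)) (c : Zn n -> 'rV[C]_r) :
    \sum_(m <- S) wf_e M m (phi (c m)) =
    \sum_(i < r) \sum_(m <- S) c m 0 i *: wf_e M m (b i).
  rewrite exchange_big; apply: eq_bigr => m _.
  by rewrite linear_sum; apply: eq_bigr => i _; rewrite linearZ.
split; last split.
- move=> x; have [S [c ->]] := span x; exists S, (fun m => \row_i c i m).
  by rewrite /= sumE; do 2![apply: eq_bigr => ? _]; rewrite mxE.
- move=> S v uS /=; rewrite sumE => /(indep S (fun i m => v m 0 i) uS) H m mS.
  by apply/rowP => i; rewrite mxE; apply: H.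
- by move=> k m w /=; rewrite eM !znE addrC.
Qed.

(** Derives one relation from another when their defects agree, an identity left to [ring]. *)
Lemma subr_transfer (V : zmodType) (a b x y : V) : a = b -> x - y = a - b -> x = y.
Proof. by move=> -> /eqP; rewrite subrr subr_eq0 => /eqP. Qed.

Definition Dinv (C : fieldType) n (U : vectType C) (D : 'I_n -> Zn n -> 'End(U))
  (Q : U -> Prop) := forall j s x, Q x -> Q (D j s x).

Section Coords.
Variables (C : numClosedFieldType) (n : nat) (M : WFmod C n) (lam : 'I_n -> C).
Variables (U : vectType C) (iota : Zn n -> {linear U -> wf_car M}).
Variable (D : 'I_n -> Zn n -> 'End(U)).
Hypothesis crd : coords lam iota D.

Let dec : tensor_decomp iota. Proof. by case: crd. Qed.

Lemma coords_d j s m v : wf_d M j s (iota m v)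
  = iota (m + s) (((m j)%:~R + lam j) *: v + D j s v).
Proof. by case: crd. Qed.

Lemma coords_dj j m v : dj M j (iota m v) = ((m j)%:~R + lam j) *: iota m v.
Proof.
case: crd => _ D0 _; rewrite /dj z0E coords_d addr0 D0 lfunE /=.
by rewrite addr0 linearZ.
Qed.

Lemma coords_law : is_WFmod M -> jetlaw D.
Proof.
move=> [rel _ _] j k s m v; have := rel j k s m (iota 0 v).
rewrite !coords_d !znE !add0r [m + s]addrC -!linearZ -!linearB => /(iota_inj dec).
rewrite !ffunE !mulr0z !add0r !linearD !linearZ /= => E.
apply: v2r_ext => i; have := congr1 (fun x => v2r x 0 i) E.
by rewrite !(linearD, linearN, linearZ) /= !mxE => e; apply: (subr_transfer e); ring.
Qed.

Lemma coords_J3 : J3 M.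
Proof.
move=> j s m; pose f := [the {linear _ -> _} of wf_d M j s \o wf_e M m].
pose g := [the {linear _ -> _} of
  ((m j)%:~R \*: wf_e M (m + s)) \+ (wf_e M m \o wf_d M j s)].
suff fg : f =1 g by move=> x; have := fg x; rewrite zaddE.
apply: (tensor_ext dec) => k w /=.
rewrite !(tensor_e dec, coords_d) -linearZ addrA [k + m + s]addrAC -linearD.
by congr (iota _ _); rewrite ffunE rmorphD /=; module_eq.
Qed.

Lemma coords_WFmod : jetlaw D -> is_WFmod M.
Proof.
move=> law; split.
- move=> j k s m.
  pose f := [the {linear _ -> _} of
    (wf_d M j s \o wf_d M k m) \- (wf_d M k m \o wf_d M j s)].
  pose g := [the {linear _ -> _} of
    ((m j)%:~R \*: wf_d M k (s + m)) \- ((s k)%:~R \*: wf_d M j (s + m))].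
  suff fg : f =1 g by move=> x; have := fg x; rewrite !zaddE.
  apply: (tensor_ext dec) => t v /=.
  rewrite !coords_d -[t + m + s]addrA -[t + s + m]addrA [m + s]addrC -!linearZ -!linearB.
  congr (iota _ _); rewrite !ffunE !rmorphD /= !linearD !linearZ /=.
  have E := law j k s m v.
  apply: v2r_ext => i; have := congr1 (fun x => v2r x 0 i) E.
  by rewrite !(linearD, linearN, linearZ) /= !mxE => e; apply: (subr_transfer e); ring.
- suff fg : wf_e M (z0 n) =1 [the {linear _ -> _} of idfun] by [].
  by apply: (tensor_ext dec) => t v /=; rewrite (tensor_e dec) znE addr0.
- move=> m k.
  suff fg : [the {linear _ -> _} of wf_e M m \o wf_e M k] =1 wf_e M (zadd m k) by [].
  by apply: (tensor_ext dec) => t v /=; rewrite !(tensor_e dec) znE -addrA [k + m]addrC.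
Qed.

Lemma coords_J1 : J1 M.
Proof.
move=> j x; have [S [v [_ _ _ ->]]] := decomp_uniq (tensor_dec dec) x.
pose h (m : Zn n) : C := (m j)%:~R + lam j.
(* Distinct m may share the j-th coordinate, so components are collected by the eigenvalue of
   d_j. *)
exists (undup (map h S)), (fun mu => \sum_(m <- S | h m == mu) iota m (v m)).
split=> [|mu _]; first exact: sum_fibers.
rewrite linear_sum scaler_sumr; apply: eq_bigr => m /eqP <-.
exact: coords_dj.
Qed.

Lemma coords_catJ : jetlaw D -> in_catJ M.
Proof.
move=> law; split; [exact: coords_WFmod|exact: coords_J1|exact: tensor_J2 dec|].
exact: coords_J3.
Qed.

Variable pr : Zn n -> {linear wf_car M -> U}.
Hypothesis prE : forall m k w, pr m (iota k w) = if k == m then w else 0.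
Hypothesis prS : forall x, exists2 S, uniq S & x = \sum_(m <- S) iota m (pr m x).

Lemma pr_eq0 x : (forall m, pr m x = 0) -> x = 0.
Proof.
by move=> x0; have [S _ ->] := prS x; rewrite big1 // => m _; rewrite x0 linear0.
Qed.

Lemma pr_d m j s x : pr m (wf_d M j s x)
  = (((m - s) j)%:~R + lam j) *: pr (m - s) x + D j s (pr (m - s) x).
Proof.
pose g := [the {linear _ -> _} of
  ((((m - s) j)%:~R + lam j) \*: pr (m - s)) \+ (D j s \o pr (m - s))].
suff fg : [the {linear _ -> _} of pr m \o wf_d M j s] =1 g by exact: fg.
apply: (tensor_ext dec) => k w /=; rewrite coords_d !prE.
rewrite -[k == _](inj_eq (addIr s)) subrK; case: eqP => [<-|_].
  by rewrite addrK.
by rewrite !linear0 addr0.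
Qed.

Lemma pr_e m k x : pr m (wf_e M k x) = pr (m - k) x.
Proof.
suff fg : [the {linear _ -> _} of pr m \o wf_e M k] =1 pr (m - k) by exact: fg.
apply: (tensor_ext dec) => l w /=; rewrite (tensor_e dec) !prE.
by rewrite -[l == _](inj_eq (addIr k)) subrK.
Qed.

Lemma iota_e m v : iota m v = wf_e M m (iota 0 v).
Proof. by rewrite (tensor_e dec) add0r. Qed.

(** The d_j act on the components by the characters lam + m, distinct in characteristic 0, so a
    submodule contains all weight components of its elements; e_{-m} carries the component of index
    m to index 0. *)
Lemma sub_graded (P : wf_car M -> Prop) : is_subspace P -> WF_inv P ->
  forall x, P x <-> forall m, P (iota 0 (pr m x)).
Proof.
move=> subP [Pd Pe] x; split=> [Px m|Px]; last first.
  have [S _ ->] := prS x; apply: subspace_sum subP _ _ _ _ => m _.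
  by rewrite iota_e; apply: Pe.
have [S uS xE] := prS x.
have PS k : k \in S -> P (iota k (pr k x)).
  apply: (joint_eigen_sum (T := dj M) (chi := fun (m : Zn n) j => (m j)%:~R + lam j)
    (x := fun k => iota k (pr k x)) _ subP _ uS).
  - move=> k1 k2 /eqP k12; apply: contra_notP k12 => k12; apply/ffunP => j.
    apply/eqP; apply: contra_notT k12 => k12; exists j.
    by rewrite (inj_eq (addIr _)) (inj_eq intr_inj).
  - by move=> j y; apply: Pd.
  - by move=> l j _; apply: coords_dj.
  - by rewrite -xE.
have [mS|mS] := boolP (m \in S).
  by have := Pe (- m) _ (PS m mS); rewrite (tensor_e dec) subrr.
rewrite {1}xE linear_sum big_seq big1 ?linear0; first exact: subspace0 subP.
by move=> k kS; rewrite prE; case: eqP => // km; rewrite -km kS in mS.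
Qed.

Lemma sub_down (P : wf_car M -> Prop) : is_subspace P -> WF_inv P ->
  is_subspace (fun u => P (iota 0 u)) /\ Dinv D (fun u => P (iota 0 u)).
Proof.
move=> subP Pinv; have [Pd Pe] := Pinv; split.
  split=> [|x y|a x]; rewrite ?linear0 ?linearD ?linearZ.
  - exact: subspace0 subP.
  - by move=> Px Py; apply: subspaceD.
  - by move=> Px; apply: subspaceZ.
move=> j s u Pu; have := Pe (- s) _ (Pd j s _ Pu).
rewrite coords_d (tensor_e dec) add0r subrr linearD linearZ /= => H.
have := subspaceB subP H (subspaceZ subP (((0 : Zn n) j)%:~R + lam j) Pu).
by rewrite [_ + iota 0 (D j s u)]addrC addrK.
Qed.

Definition sub_up (Q : U -> Prop) (x : wf_car M) := forall m, Q (pr m x).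

Lemma sub_upP (Q : U -> Prop) : is_subspace Q -> Dinv D Q ->
  [/\ is_subspace (sub_up Q), WF_inv (sub_up Q) & forall m u, Q u -> sub_up Q (iota m u)].
Proof.
move=> subQ QD; split.
- split=> [m|x y Px Py m|a x Px m]; rewrite ?linear0 ?linearD ?linearZ.
  + exact: subspace0 subQ.
  + exact: (subspaceD subQ (Px m) (Py m)).
  + exact: (subspaceZ subQ _ (Px m)).
- split=> [j s x Px m|k x Px m]; last by rewrite pr_e.
  by rewrite pr_d; apply: (subspaceD subQ); [apply: (subspaceZ subQ); apply: Px|apply/QD/Px].
- by move=> m u Qu k; rewrite prE; case: ifP => // _; apply: subspace0.
Qed.

End Coords.

(** * Submodules and isomorphisms of F(T^n) (x) U *)

Lemma eq_indecomposable (C : fieldType) (V : lmodType C)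
    (inv inv' : (V -> Prop) -> Prop) :
  (forall P, is_subspace P -> inv P <-> inv' P) ->
  indecomposable inv <-> indecomposable inv'.
Proof.
move=> eqinv; split=> -[nz nodec]; split=> // -[P [Q [[sP iP sQ iQ] H]]];
  by apply: nodec; exists P, Q; split=> //; split=> //; apply/eqinv.
Qed.

Lemma eq_irreducible (C : fieldType) (V : lmodType C)
    (inv inv' : (V -> Prop) -> Prop) :
  (forall P, is_subspace P -> inv P <-> inv' P) ->
  irreducible inv <-> irreducible inv'.
Proof.
by move=> eqinv; split=> -[nz irr]; split=> // P sP /(eqinv P sP); apply: irr.
Qed.

Lemma irreducible_indecomposable (C : fieldType) (V : lmodType C)
    (inv : (V -> Prop) -> Prop) : irreducible inv -> indecomposable inv.
Proof.
move=> [nz irr]; split=> // -[P [Q [[sP iP sQ iQ] [[x [Px x0]] [y [Qy y0]] PQ _]]]].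
have [P0|Pall] := irr P sP iP; first exact: x0 (P0 _ Px).
exact/y0/PQ.
Qed.

Lemma add_subspace (C : fieldType) (V : lmodType C) (P Q : V -> Prop) :
  is_subspace P -> is_subspace Q ->
  is_subspace (fun x => exists y z, [/\ P y, Q z & x = y + z]).
Proof.
move=> sP sQ; split.
- exists 0, 0; rewrite addr0; split=> //; exact: subspace0.
- move=> _ _ [y [z [Py Qz ->]]] [y' [z' [Py' Qz' ->]]].
  by exists (y + y'), (z + z'); rewrite addrACA; split=> //; apply: subspaceD.
- move=> a _ [y [z [Py Qz ->]]].
  by exists (a *: y), (a *: z); rewrite scalerDr; split=> //; apply: subspaceZ.
Qed.

Section CoordsModule.
Variables (C : numClosedFieldType) (n : nat) (M : WFmod C n) (lam : 'I_n -> C).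
Variables (U : vectType C) (iota : Zn n -> {linear U -> wf_car M}).
Variable (D : 'I_n -> Zn n -> 'End(U)).
Hypothesis crd : coords lam iota D.

Let dec : tensor_decomp iota. Proof. by case: crd. Qed.

Lemma iota_neq0 m u : u <> 0 -> iota m u <> 0.
Proof. by move=> u0; rewrite -(linear0 (iota m)) => /(iota_inj dec). Qed.

Lemma coords_indecomposable : WF_indecomposable M <-> indecomposable (@Dinv C n U D).
Proof.
have [pr [prE prS]] := tensor_proj dec.
split=> -[[x x0] nodec]; split.
- by apply: contra_notP x0 => nou; apply: (pr_eq0 prS) => m;
    apply: contra_notP nou => mx; exists (pr m x).
- move=> [P [Q [[sP iP sQ iQ] [[y [Py y0]] [z [Qz z0]] PQ0 PQ]]]]; apply: nodec.
  have [sP' iP' PU] := sub_upP crd prE sP iP; have [sQ' iQ' QU] := sub_upP crd prE sQ iQ.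
  exists (sub_up pr P), (sub_up pr Q); split=> //; split.
  + by exists (iota 0 y); split; [apply: PU|apply: iota_neq0].
  + by exists (iota 0 z); split; [apply: QU|apply: iota_neq0].
  + by move=> w Pw Qw; apply: (pr_eq0 prS) => m; apply: PQ0.
  + move=> w; have [S _ ->] := prS w.
    apply: (subspace_sum (add_subspace sP' sQ')) => m _.
    have [u [v [Pu Qv ->]]] := PQ (pr m w); exists (iota m u), (iota m v).
    by rewrite linearD; split; [apply: PU|apply: QU|].
- by exists (iota 0 x); apply: iota_neq0.
- move=> [P [Q [[sP iP sQ iQ] [[y [Py y0]] [z [Qz z0]] PQ0 PQ]]]]; apply: nodec.
  have [sP' iP'] := sub_down crd sP iP; have [sQ' iQ'] := sub_down crd sQ iQ.
  have grP := sub_graded crd prE prS sP iP.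
  have grQ := sub_graded crd prE prS sQ iQ.
  exists (fun u => P (iota 0 u)), (fun u => Q (iota 0 u)); split=> //; split.
  + apply: contra_notP y0 => nou; apply: (pr_eq0 prS) => m.
    by apply: contra_notP nou => my; exists (pr m y); split=> //; apply: ((grP y).1 Py).
  + apply: contra_notP z0 => nou; apply: (pr_eq0 prS) => m.
    by apply: contra_notP nou => mz; exists (pr m z); split=> //; apply: ((grQ z).1 Qz).
  + move=> u Pu Qu; apply: (iota_inj dec (m := 0)); rewrite linear0; exact: PQ0.
  + move=> u; have [v [w [Pv Qw E]]] := PQ (iota 0 u).
    exists (pr 0 v), (pr 0 w); split; [exact: ((grP v).1 Pv)|exact: ((grQ w).1 Qw)|].
    by rewrite -linearD -E prE eqxx.
Qed.

Lemma coords_irreducible : WF_irreducible M <-> irreducible (@Dinv C n U D).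
Proof.
have [pr [prE prS]] := tensor_proj dec.
split=> -[[x x0] irr]; split.
- by apply: contra_notP x0 => nou; apply: (pr_eq0 prS) => m;
    apply: contra_notP nou => mx; exists (pr m x).
- move=> P sP iP; have [sP' iP' PU] := sub_upP crd prE sP iP.
  have [H|H] := irr _ sP' iP'; [left=> u Pu|right=> u].
    by apply: (iota_inj dec (m := 0)); rewrite linear0; apply/H/PU.
  by have := H (iota 0 u) 0; rewrite prE eqxx.
- by exists (iota 0 x); apply: iota_neq0.
- move=> P sP iP; have [sP' iP'] := sub_down crd sP iP.
  have gr := sub_graded crd prE prS sP iP.
  have [H|H] := irr _ sP' iP'; [left=> w Pw|right=> w].
    by apply: (pr_eq0 prS) => m; apply/H/((gr w).1 Pw).
  by apply/gr => m; apply: H.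
Qed.

End CoordsModule.

(** An isomorphism carries the weight space of [lam] onto a single component [iota' k] of M': k is
    the shift between [lam] and [lam'], and g is the induced map of fibres. A nonzero vector of U
    serves to find k. *)
Lemma coords_iso (C : numClosedFieldType) n (M M' : WFmod C n) (lam lam' : 'I_n -> C)
    (U U' : vectType C) (iota : Zn n -> {linear U -> wf_car M})
    (iota' : Zn n -> {linear U' -> wf_car M'}) D D' :
  coords lam iota D -> coords lam' iota' D' -> (exists u : U, u <> 0) ->
  WF_iso M M' <->
  same_class lam lam' /\
  exists g : {linear U -> U'}, bijective g /\
    forall j s u, g (D j s u) = D' j s (g u).
Proof.
move=> crd crd' [u0 u0N]; have [dec _ _] := crd; have [dec' D'0 _] := crd'.
have [pr [prE prS]] := tensor_proj dec; have [pr' [prE' prS']] := tensor_proj dec'.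
split=> [[f [[f1 fK f1K] [fd fe]]]|[[k lamE] [g [[g1 gK g1K] gD]]]].
(* The component of index m of the image of a [lam]-vector survives only if lam' + m = lam. *)
- have wt (m : Zn n) j u : ((m j)%:~R + lam' j) *: pr' m (f (iota 0 u))
      = lam j *: pr' m (f (iota 0 u)).
    have := congr1 (pr' m) (fd j 0 (iota 0 u)).
    rewrite (pr_d crd' prE') subr0 D'0 lfunE addr0 => <-.
    have := coords_dj crd j 0 u; rewrite /dj z0E => ->.
    by rewrite ffunE add0r !linearZ.
  have [k kN] : exists k, pr' k (f (iota 0 u0)) <> 0.
    have: f (iota 0 u0) <> 0.
      move=> /(congr1 f1); rewrite fK -(linear0 f) fK.
      exact: iota_neq0 crd _ _ u0N.
    apply: contra_notP => nok; apply: (pr_eq0 prS') => m.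
    by apply: contra_notP nok => mN; exists m.
  have lamE j : lam j = (k j)%:~R + lam' j.
    apply/esym/eqP; rewrite -subr_eq0; have /eqP := wt k j u0.
    rewrite -subr_eq0 -scalerBl scaler_eq0 => /orP[//|/eqP]; exact: contraPT.
  pose g := [the {linear _ -> _} of pr' k \o (f \o iota 0)].
  have fg u : f (iota 0 u) = iota' k (g u).
    apply/eqP; rewrite -subr_eq0; apply/eqP/(pr_eq0 prS') => m.
    rewrite linearB prE'; case: eqP => [<-|km]; first by rewrite subrr.
    rewrite subr0; have [j kmj] : exists j, k j != m j.
      apply: contra_notP km => km'; apply/ffunP => j; apply/eqP.
      by apply: contra_notT km' => ?; exists j.
    have /eqP := wt m j u; rewrite lamE -subr_eq0 -scalerBl scaler_eq0.
    rewrite opprD addrACA subrr addr0 -rmorphB intr_eq0 subr_eq0 eq_sym (negPf kmj).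
    by move=> /eqP.
  have fi m w : f (iota m w) = iota' (k + m) (g w).
    by rewrite (iota_e crd) fe fg (tensor_e dec').
  have gpr x : pr' k (f x) = g (pr 0 x).
    suff fgx : [the {linear _ -> _} of pr' k \o f] =1 [the {linear _ -> _} of g \o pr 0].
      exact: fgx.
    apply: (tensor_ext dec) => m w /=; rewrite fi prE' prE.
    rewrite -{2}[k]addr0 (inj_eq (addrI k)).
    by case: eqP; rewrite ?linear0.
  split.
    by exists (- k) => j; rewrite lamE ffunE rmorphN /= addrAC subrr add0r.
  exists g; split.
    exists (fun u => pr 0 (f1 (iota' k u))) => u; first by rewrite -fg fK prE eqxx.
    by rewrite -gpr f1K prE' eqxx.
  move=> j s u; have := congr1 (pr' (k + s)) (fd j s (iota 0 u)).
  rewrite (coords_d crd) fi fg (coords_d crd') !prE' !add0r eqxx !ffunE add0r lamE.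
  rewrite linearD linearZ => /addrI; exact.
(* Since lam' = lam + k, component m of M has the weight of component m - k of M'. *)
- pose i m := [the {linear _ -> _} of iota' (m - k) \o g].
  have g1lin := can2_linear gK g1K.
  pose i' m := [the {linear _ -> _} of iota (m + k) \o mk_linear g1lin].
  have [f fE] := tensor_lift dec i; have [f' fE'] := tensor_lift dec' i'.
  exists f; split; [exists f'|split].
  + suff H : [the {linear _ -> _} of f' \o f] =1 [the {linear _ -> _} of idfun] by exact: H.
    by apply: (tensor_ext dec) => m w /=; rewrite fE /= fE' /= gK subrK.
  + suff H : [the {linear _ -> _} of f \o f'] =1 [the {linear _ -> _} of idfun] by exact: H.
    by apply: (tensor_ext dec') => m w /=; rewrite fE' /= fE /= g1K addrK.
  + move=> j s x.
    suff H : [the {linear _ -> _} of f \o wf_d M j s]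
        =1 [the {linear _ -> _} of wf_d M' j s \o f] by exact: H.
    apply: (tensor_ext dec) => m w /=.
    rewrite (coords_d crd) !fE /= (coords_d crd') [m + s - k]addrAC.
    congr (iota' _ _); rewrite linearD linearZ gD lamE !ffunE rmorphB /=.
    by congr (_ *: _ + _); ring.
  + move=> m x.
    suff H : [the {linear _ -> _} of f \o wf_e M m]
        =1 [the {linear _ -> _} of wf_e M' m \o f] by exact: H.
    apply: (tensor_ext dec) => l w /=.
    by rewrite (tensor_e dec) !fE /= (tensor_e dec') [l + m - k]addrAC.
Qed.

(** * Polynomiality *)

Section Coefficients.
Variables (C : numClosedFieldType) (n : nat).

Lemma spowM (s t : Zn n) (a : MI n) :
  spow C ([ffun i => s i * t i] : Zn n) a = spow C s a * spow C t a.
Proof.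
rewrite /spow -big_split; apply: eq_bigr => i _.
by rewrite ffunE rmorphM exprMn.
Qed.

Lemma spow_sep (a b : MI n) : a != b -> exists t : Zn n, spow C t a != spow C t b.
Proof.
move=> ab; have [i abi] : exists i, a i != b i.
  apply: contraNP ab => nab; apply/eqP/ffunP => i; apply/eqP.
  by apply: contra_notT nab => ?; exists i.
(* With 2 at a coordinate where a and b differ, t^a and t^b are distinct powers of 2. *)
exists [ffun k => if k == i then 2 else 1].
have E (c : MI n) : spow C ([ffun k => if k == i then 2 else 1] : Zn n) c = 2 ^+ c i.
  rewrite /spow (bigD1 i) //= ffunE eqxx big1 ?mulr1 // => k /negPf ki.
  by rewrite ffunE ki expr1n.
rewrite !E -!natrX eqr_nat; apply: contraNneq abi => /eqP.
by rewrite eqn_exp2l.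
Qed.

Variables (V : lmodType C) (P : V -> Prop).
Hypothesis subP : is_subspace P.

(** On functions Z^n -> V the dilations f(s) -> f(t s), with coordinatewise product, have s -> s^a
    v_a as joint eigenvectors with distinct characters t^a. So each term of a P-valued sum is
    P-valued, and s = (1,...,1) gives v_a. The case P = 0 is uniqueness of coefficients; general P
    serves for invariant subspaces. *)
Lemma spow_coef (A : seq (MI n)) (v : MI n -> V) : uniq A ->
  (forall s, P (\sum_(a <- A) spow C s a *: v a)) -> forall a, a \in A -> P (v a).
Proof.
move=> uA PA a aA.
pose F := Zn n -> V; pose mul (t s : Zn n) : Zn n := [ffun i => t i * s i].
have Tlin t : linear (fun (f : F) => (fun s => f (mul t s)) : F) by [].
pose PF (f : F) := forall s, P (f s).
have sPF : is_subspace PF.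
  split=> [s|f g Pf Pg s|c f Pf s]; first exact: subspace0 subP.
    exact: (subspaceD subP (Pf s) (Pg s)).
  exact: (subspaceZ subP c (Pf s)).
have fsum (x : MI n -> F) s : (\sum_(b <- A) x b) s = \sum_(b <- A) x b s.
  by elim/big_rec2: _ => // b y1 y2 _ <-.
have := @joint_eigen_sum C F _ _ (fun t => mk_linear (Tlin t))
  (fun (a : MI n) t => spow C t a) PF _ sPF _ A (fun a s => spow C s a *: v a) uA.
move=> H; have /(_ a aA [ffun=> 1]) : forall k, k \in A -> PF (fun s => spow C s k *: v k).
  apply: H.
  - exact: spow_sep.
  - by move=> t f Pf s; apply: Pf.
  - move=> b t _; apply: funext => s /=.
    by rewrite spowM -scalerA.
  - by move=> s; rewrite fsum.
rewrite /spow big1 ?scale1r // => i _.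
by rewrite ffunE expr1n.
Qed.

Lemma mifact_neq0 (a : MI n) : (mifact a)%:R != 0 :> C.
Proof. by rewrite pnatr_eq0 -lt0n prodn_gt0 // => i; apply: fact_gt0. Qed.

Lemma tcoef_coef (A : seq (MI n)) (v : MI n -> V) : uniq A ->
  (forall s, P (\sum_(a <- A) tcoef C s a *: v a)) -> forall a, a \in A -> P (v a).
Proof.
move=> uA PA a aA; apply: (subspaceZK subP (a := (mifact a)%:R^-1)).
  by rewrite invr_eq0 mifact_neq0.
apply: (@spow_coef A (fun a => (mifact a)%:R^-1 *: v a)) aA => // s.
by under eq_bigr do rewrite scalerA; exact: PA.
Qed.

End Coefficients.

Section Eigenvalues.
Variables (C : numClosedFieldType) (V : vectType C) (f : {linear V -> V}).

Let A := lin1_mx (v2r \o f \o r2v).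

Let eigenA x mu : (v2r x *m A == mu *: v2r x) = (f x == mu *: x).
Proof.
by rewrite mul_rV_lin1 /= v2rK -linearZ (inj_eq (can_inj v2rK)).
Qed.

Lemma eigenvalues_finite :
  exists rs : seq C, forall mu x, f x = mu *: x -> x <> 0 -> mu \in rs.
Proof.
have [rs rsE] := closed_field_poly_normal (char_poly A).
exists rs => mu x fx x0.
have : eigenvalue A mu.
  apply/eigenvalueP; exists (v2r x); first by apply/eqP; rewrite eigenA fx.
  by apply/eqP => vx0; apply: x0; apply: (can_inj v2rK); rewrite vx0 linear0.
rewrite eigenvalue_root_char rsE rootZ ?root_prod_XsubC //.
by rewrite (monicP (char_poly_monic A)) oner_neq0.
Qed.

Lemma eigenvector_exists : (exists x : V, x <> 0) ->
  exists mu x, f x = mu *: x /\ x <> 0.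
Proof.
move=> [x x0]; have [|mu] := closed_rootP (char_poly A) _.
  rewrite size_char_poly; apply/eqP => -[d0]; apply: x0.
  by apply: v2r_ext => -[i ilt]; exfalso; rewrite d0 in ilt.
rewrite -eigenvalue_root_char => /eigenvalueP[v vA v0].
exists mu, (r2v v); split.
  by apply/eqP; rewrite -eigenA r2vK vA.
by move=> /(congr1 v2r); rewrite r2vK linear0; apply/eqP.
Qed.

End Eigenvalues.

(** Each element of [rs] is c + b for at most one b. In the applications [rs] comes from the
    spectrum of an operator. *)
Lemma shift_notin (C : numDomainType) (rs : seq C) (c : C) :
  exists N, forall b : nat, (N <= b)%N -> c + b%:R \notin rs.
Proof.
elim: rs => [|r rs [N IH]]; first by exists 0%N.
have [[k kr]|nok] := pselect (exists k : nat, c + k%:R = r).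
  exists (maxn N k.+1) => b; rewrite geq_max => /andP[/IH Nb kb].
  rewrite in_cons negb_or Nb -kr andbT (inj_eq (addrI c)) eqr_nat.
  by rewrite neq_ltn kb orbT.
exists N => b /IH Nb; rewrite in_cons negb_or Nb andbT.
by apply: contra_notN nok => /eqP <-; exists b.
Qed.

(** * Finite differences of sequences indexed by the integers *)

Section Differences.
Variables (C : numFieldType) (V : vectType C).
Implicit Types (F H : int -> V) (c : int).

Definition dlt F c := F (c + 1) - F c.

Lemma iter_dltS b F c :
  iter b.+1 dlt F c = iter b dlt F (c + 1) - iter b dlt F c.
Proof. by []. Qed.

Lemma iter_dltD b F H c :
  iter b dlt (fun x => F x + H x) c = iter b dlt F c + iter b dlt H c.
Proof.
by elim: b c => [//|b IH] c; rewrite !iter_dltS !IH opprD addrACA.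
Qed.

Lemma iter_dltZ b (k : C) F c :
  iter b dlt (fun x => k *: F x) c = k *: iter b dlt F c.
Proof. by elim: b c => [//|b IH] c; rewrite !iter_dltS !IH scalerBr. Qed.

Lemma iter_dlt_lin (f : {linear V -> V}) b F c :
  iter b dlt (fun x => f (F x)) c = f (iter b dlt F c).
Proof. by elim: b c => [//|b IH] c; rewrite !iter_dltS !IH linearB. Qed.

Lemma iter_dltN b F c : iter b dlt (fun x => - F x) c = - iter b dlt F c.
Proof. by elim: b c => [//|b IH] c; rewrite !iter_dltS !IH opprB opprK addrC. Qed.

Lemma iter_dlt_const b (v : V) c : iter b.+1 dlt (fun=> v) c = 0.
Proof. by elim: b c => [|b IH] c; rewrite iter_dltS ?IH ?subrr. Qed.

Lemma iter_dlt_shift b F a c :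
  iter b dlt (fun x => F (a + x)) c = iter b dlt F (a + c).
Proof. by elim: b c => [//|b IH] c; rewrite !iter_dltS !IH addrA. Qed.

(** Discrete Leibniz rule for multiplication by x. The factor [b.+1] is the source of the pairwise
    distinct eigenvalues used in [differences_vanish]. *)
Lemma iter_dlt_leibniz b F c :
  iter b.+1 dlt (fun x => x%:~R *: F x) c =
  c%:~R *: iter b.+1 dlt F c + b.+1%:R *: iter b dlt F (c + 1).
Proof.
have E d (x0 x1 y0 y1 : V) (k : C) :
    (d + 1)%:~R *: x1 + k *: y1 - (d%:~R *: x0 + k *: y0)
    = d%:~R *: (x1 - x0) + (x1 + k *: (y1 - y0)).
  by rewrite rmorphD; module_eq.
elim: b c => [|b IH] c.
  have := E c (F c) (F (c + 1)) 0 0 0; rewrite !scale0r !addr0 => H.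
  by rewrite scale1r; apply: H.
by rewrite iter_dltS !IH E -!iter_dltS [b.+2%:R]mulrS scalerDl scale1r.
Qed.

(** The difference of order b at c + 1 is the sum of those of orders b and b + 1 at c. This moves
    upwards only; negative integers are reached differently. *)
Lemma iter_dlt_nat N F : (forall b, (N <= b)%N -> iter b dlt F 0 = 0) ->
  forall (c : nat) b, (N <= b)%N -> iter b dlt F c%:Z = 0.
Proof.
move=> F0; elim=> [//|c IH] b Nb.
have := iter_dltS b F c; rewrite !IH ?subr0 ?leqW // => /esym.
by rewrite -addn1 PoszD.
Qed.

End Differences.

(* [ad a] stands for the bracket with [G a].  The bracket with [G (-1)], which
   plays the role of the vector field (q - 1) d/dq, has the differences of [H]
   as eigenvectors, with eigenvalues dl - b: those of large order vanish. This
   gives polynomiality on c >= 0; comparing the relations for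
   (a, c) = (t, 0) and (t - 1, 1) extends it to all integers. *)
Lemma differences_vanish (C : numClosedFieldType) (V : vectType C)
    (g : {linear V -> V}) :
  exists N : nat, forall (dl : bool) (ad : int -> {linear V -> V}) (G H : int -> V),
    ad (-1) =1 g ->
    (forall a c : int, ad a (H c)
      = c%:~R *: (H (a + c) - H c) - (a%:~R * dl%:R) *: (H (a + c) - G a)) ->
    forall c, iter N (@dlt C V) H c = 0.
Proof.
have [rs rsP] := eigenvalues_finite g.
(* The shifts 0 and -1 correspond to the eigenvalues -b for [dl] false and 1 - b for [dl] true; N
   has to serve both. *)
have [N0 N0P] := shift_notin [seq - r | r <- rs] 0.
have [N1 N1P] := shift_notin [seq - r | r <- rs] (-1).
(* The successor leaves room for [W], whose difference is [Y]. *)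
pose N := (maxn N0 N1).+1; exists N => dl ad G H adg rel.
(* For [dl] true the relation at a = -1 has an extra term in H (c - 1); shifting the argument by one
   absorbs it into the factor c and leaves a multiple of K c. *)
pose K c := H (c - dl%:Z).
have gK c : g (K c) = - (c%:~R *: dlt (fun x => K (-1 + x)) c)
    + (dl%:R *: K c - dl%:R *: G (-1)).
  rewrite /K -adg rel /dlt.
  have -> : -1 + (c + 1) = c by ring.
  have -> : -1 + (c - dl%:Z) = -1 + c - dl%:Z by ring.
  have -> : (c - dl%:Z)%:~R = c%:~R - dl%:R :> C by rewrite rmorphB.
  have -> : (-1)%:~R = -1 :> C by rewrite rmorphN.
  by module_eq.
(* At the point 0 the Leibniz rule loses its term with factor c, its shift by 1 cancels the shift by
   -1 in [gK], and the constant [G (-1)] has zero differences. *)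
have gX b : g (iter b.+1 (@dlt C V) K 0) = (dl%:R - b.+1%:R) *: iter b.+1 (@dlt C V) K 0.
  rewrite -iter_dlt_lin (funext gK : (fun x => g (K x)) = _).
  rewrite iter_dltD iter_dltN iter_dlt_leibniz scale0r !add0r.
  rewrite [X in _ + X]iter_dltD iter_dlt_const addr0 iter_dltZ -iterSr iter_dlt_shift addNr.
  by rewrite scalerBl addrC.
have X0 b : (N <= b)%N -> iter b (@dlt C V) K 0 = 0.
  case: b => // b; rewrite ltnS geq_max => /andP[b0 b1].
  apply: contrapT => Xn0; have mem := rsP _ _ (gX b) Xn0.
  have {}mem : - (dl%:R - b.+1%:R) \in [seq - r | r <- rs] by apply: map_f.
  case: dl mem {rel gK gX K Xn0} => mem.
    have E : -1 + b.+1%:R = - (true%:R - b.+1%:R) :> C by rewrite opprB addrC.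
    by have := N1P b.+1 (leqW b1); rewrite E mem.
  have E : 0 + b.+1%:R = - (false%:R - b.+1%:R) :> C by rewrite opprB subr0 add0r.
  by have := N0P b.+1 (leqW b0); rewrite E mem.
have KH b c : iter b (@dlt C V) H c = iter b (@dlt C V) K (dl%:Z + c).
  rewrite -iter_dlt_shift; congr (iter _ _ _ _); apply: funext => x.
  by rewrite /K addrC addKr.
have Y0 (c : nat) : iter N (@dlt C V) H c%:Z = 0.
  by rewrite KH -PoszD; exact: (iter_dlt_nat X0 _ (leqnn N)).
set W := iter (maxn N0 N1) (@dlt C V) H; set Y := iter N (@dlt C V) H in Y0 *.
(* This makes the [W] terms of the two relations compared below agree; their difference is then (1 +
   dl) Y t = 0. *)
have W12 : W 2 = W 1 by apply/eqP; rewrite -subr_eq0; apply/eqP; apply: (Y0 1%N).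
have Z a c : ad a (Y c) = c%:~R *: (Y (a + c) - Y c)
    + N%:R *: (W (a + (c + 1)) - W (c + 1)) - (a%:~R * dl%:R) *: Y (a + c).
  rewrite /Y -iter_dlt_lin (_ : (fun x => ad a (H x)) = (fun c : int =>
      c%:~R *: H (a + c) - c%:~R *: H c - ((a%:~R * dl%:R) *: (H (a + c) - G a)))).
    rewrite !(iter_dltD, iter_dltN) iter_dltZ iter_dltD iter_dlt_const addr0.
    rewrite !iter_dlt_leibniz !iter_dlt_shift -/W -/Y -/N.
    by move: (N) => N'; module_eq.
  by apply: funext => x; rewrite rel scalerBr.
move=> t.
have e1 := Z (t - 1) 1; have e2 := Z t 0; move: e1 e2.
have -> : t - 1 + 1 = t by ring.
have -> : t - 1 + (1 + 1) = t + 1 by ring.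
rewrite addr0 add0r (Y0 0%N) (Y0 1%N) [W (1 + 1)]W12 !linear0.
have -> : (t - 1)%:~R = t%:~R - 1 :> C by rewrite rmorphB.
move: (Y t) (W _) (W _) (N%:R : C) => y w1 w2 N' e1 e2.
have /eqP : (1 + dl%:R : C) *: y = 0.
  apply: (subr_transfer (etrans (esym e1) e2)).
  by case: (dl) => /=; module_eq.
rewrite scaler_eq0 => /orP[|/eqP //].
by rewrite -[1]/(1%:R) -natrD pnatr_eq0.
Qed.

(** * Newton interpolation and polynomial functions on Z^n *)

Section Newton.
Variable C : numFieldType.

(** The binomial coefficient x (x - 1) ... (x - b + 1) / b!. *)
Fixpoint newton b (x : C) : C :=
  if b is b'.+1 then b'.+1%:R^-1 * ((x - b'%:R) * newton b' x) else 1.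

Lemma newtonS b x : newton b.+1 (x + 1) = b.+1%:R^-1 * ((x + 1) * newton b x).
Proof.
elim: b => [|b IH]; first by rewrite /= subr0.
rewrite [LHS]/= -/(newton b.+1 (x + 1)) IH /=.
have -> : x + 1 - b.+1%:R = x - b%:R by rewrite -natr1; ring.
by move: (b.+2%:R^-1) (b.+1%:R^-1) => c d; ring.
Qed.

Lemma newton_diff b x : newton b.+1 (x + 1) - newton b.+1 x = newton b x.
Proof.
rewrite newtonS /= -mulrBr -mulrBl.
have -> : x + 1 - (x - b%:R) = b.+1%:R by rewrite -natr1; ring.
by rewrite mulKf // pnatr_eq0.
Qed.

Lemma newton0 b : newton b.+1 0 = 0.
Proof.
elim: b => [|b IH]; first by rewrite /= subrr mul0r mulr0.
by rewrite /= -/(newton b.+1 0) IH !mulr0.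
Qed.

Lemma int_step (T : Type) (f : int -> T) : (forall x, f (x + 1) = f x) ->
  forall x, f x = f 0.
Proof.
move=> fS; have fP (x : nat) : f x%:Z = f 0.
  by elim: x => // x IH; rewrite -addn1 PoszD fS.
case=> [//|x]; elim: x => [|x IH]; last by rewrite -IH -fS; congr f; lia.
by rewrite -(fS (Negz 0)); congr f; lia.
Qed.

(** Both sides agree at 0 and, by induction applied to [dlt f], have the same forward difference. *)
Lemma newton_interpolation (V : vectType C) N (f : int -> V) :
  (forall c, iter N (@dlt C V) f c = 0) ->
  forall x : int, f x = \sum_(b < N) newton b x%:~R *: iter b (@dlt C V) f 0.
Proof.
elim: N f => [|N IH] f f0 x; first by rewrite big_ord0; apply: f0.
have /IH {}IH : forall c, iter N (@dlt C V) (dlt f) c = 0.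
  by move=> c; rewrite -iterSr.
pose p (y : int) := f y
  - \sum_(b < N.+1) newton b y%:~R *: iter b (@dlt C V) f 0.
have p0 : p 0 = 0.
  rewrite /p big_ord_recl /= scale1r big1 ?addr0 ?subrr // => b _.
  by rewrite -/(newton b.+1 0) newton0 scale0r.
suff : p x = 0 by move=> /eqP; rewrite subr_eq0 => /eqP.
rewrite -p0; apply: int_step => y; apply/eqP; rewrite -subr_eq0 /p.
rewrite opprD addrACA -/(dlt f y) IH -opprD subr_eq0 -sumrB.
rewrite big_ord_recl /= subrr add0r; apply/eqP/eq_bigr => b _.
by rewrite -scalerBl rmorphD newton_diff -iterSr.
Qed.

End Newton.

Section PolyFun.
Variables (C : numClosedFieldType) (n : nat) (V : vectType C).
Implicit Types (f g : Zn n -> V) (s : Zn n) (i : 'I_n) (c : int).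

Definition polyfun f := exists l : seq (MI n * V),
  forall s, f s = \sum_(p <- l) spow C s p.1 *: p.2.

Lemma polyfun0 : polyfun (fun=> 0).
Proof. by exists [::] => s; rewrite big_nil. Qed.

Lemma polyfunD f g : polyfun f -> polyfun g -> polyfun (fun s => f s + g s).
Proof.
by move=> [l fl] [l' gl]; exists (l ++ l') => s; rewrite big_cat fl gl.
Qed.

Lemma polyfunZ k f : polyfun f -> polyfun (fun s => k *: f s).
Proof.
move=> [l fl]; exists [seq (p.1, k *: p.2) | p <- l] => s.
rewrite fl big_map scaler_sumr; apply: eq_bigr => p _ /=.
by rewrite !scalerA mulrC.
Qed.

Lemma polyfun_sum (I : Type) (r : seq I) (f : I -> Zn n -> V) :
  (forall k, polyfun (f k)) -> polyfun (fun s => \sum_(k <- r) f k s).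
Proof.
move=> fP; elim: r => [|k r IH].
  by have [l lE] := polyfun0; exists l => s; rewrite big_nil -lE.
by have [l lE] := polyfunD (fP k) IH; exists l => s; rewrite big_cons -lE.
Qed.

Lemma polyfunX i f : polyfun f -> polyfun (fun s => (s i)%:~R *: f s).
Proof.
move=> [l fl]; pose incr (a : MI n) : MI n := [ffun k => (a k + (k == i))%N].
exists [seq (incr p.1, p.2) | p <- l] => s.
rewrite fl big_map scaler_sumr; apply: eq_bigr => p _ /=.
rewrite scalerA /spow; congr (_ *: _).
rewrite (bigD1 i) //= [RHS](bigD1 i) //= ffunE eqxx addn1 exprS mulrA.
congr (_ * _); apply: eq_bigr => k /negPf ki.
by rewrite ffunE ki addn0.
Qed.

Lemma polyfun_newton i b f : polyfun f -> polyfun (fun s => newton b (s i)%:~R *: f s).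
Proof.
move=> fP; elim: b => [|b IH].
  by have [l fl] := fP; exists l => s; rewrite scale1r.
have := polyfunZ b.+1%:R^-1 (polyfunD (polyfunX i IH) (polyfunZ (- b%:R) IH)).
by move=> [l lE]; exists l => s; rewrite -lE -scalerDl !scalerA /= mulrA.
Qed.

Definition upd s i c : Zn n := [ffun k => if k == i then c else s k].

Lemma iter_dlt0 b c : iter b (@dlt C V) (fun=> 0) c = 0.
Proof. by elim: b c => [//|b IH] c; rewrite iter_dltS !IH subrr. Qed.

Lemma iter_dlt_comm M b (F : int -> int -> V) x y :
  iter M (@dlt C V) (fun y => iter b (@dlt C V) (fun x => F x y) x) y =
  iter b (@dlt C V) (fun x => iter M (@dlt C V) (F x) y) x.
Proof.
elim: b x => [//|b IH] x; rewrite [RHS]iter_dltS -!IH -iter_dltN -iter_dltD.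
by [].
Qed.

(** Induction on the number k of coordinates on which the function depends: Newton interpolation in
    the last of them, possible with one N for all s, has coefficients [h b] depending on one
    coordinate fewer. *)
Lemma polyfun_of_differences f :
  (forall i, exists N, forall s c, iter N (@dlt C V) (fun x => f (upd s i x)) c = 0) ->
  polyfun f.
Proof.
pose dep k (f : Zn n -> V) :=
  forall s s', (forall i : 'I_n, (i < k)%N -> s i = s' i) -> f s = f s'.
suff H k g : (k <= n)%N -> dep k g ->
    (forall i, exists N, forall s c, iter N (@dlt C V) (fun x => g (upd s i x)) c = 0) ->
    polyfun g.
  by apply: (H n) => // s s' ss'; congr f; apply/ffunP => i; apply: ss'.
elim: k g => [|k IH] g kn gk gN.
  exists [:: (mi0 n, g 0)] => s; rewrite big_seq1 /= /spow big1.
    by rewrite scale1r; apply: gk.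
  by move=> i _; rewrite ffunE expr0.
pose i := Ordinal kn; have [N Ni] := gN i.
pose h b s := iter b (@dlt C V) (fun x => g (upd s i x)) 0.
have gE s : g s = \sum_(b <- index_enum 'I_N) newton b (s i)%:~R *: h b s.
  rewrite -newton_interpolation //; congr g; apply/ffunP => j.
  by rewrite ffunE; case: eqP => [->|].
have [l lE] : polyfun (fun s => \sum_(b <- index_enum 'I_N) newton b (s i)%:~R *: h b s).
  apply: polyfun_sum => b; apply: polyfun_newton; apply: IH (ltnW kn) _ _.
    move=> s s' ss'; rewrite /h; congr (iter _ _ _ _); apply: funext => x.
    apply: gk => j; rewrite !ffunE; case: eqP => // /eqP ji; rewrite ltnS leq_eqVlt.
    by rewrite (negPf (ji : (j : nat) != k)); apply: ss'.
  (* Along i the function [h b] is constant; along another j its differences vanish because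
     differences in distinct coordinates commute. *)
  move=> j; have [->|ji] := eqVneq j i.
    exists 1%N => s c; rewrite /= /dlt /h; apply/eqP; rewrite subr_eq0; apply/eqP.
    congr (iter _ _ _ _); apply: funext => x; congr g; apply/ffunP => l.
    by rewrite !ffunE; case: eqP.
  have [M Mj] := gN j; exists M => s c.
  rewrite /h iter_dlt_comm.
  rewrite (_ : (fun x => _) = (fun=> 0)).
    exact: iter_dlt0.
  apply: funext => x; rewrite -(Mj (upd s i x) c); congr (iter _ _ _ _).
  apply: funext => y; congr g; apply/ffunP => l; rewrite !ffunE.
  by case: eqP => // ->; rewrite eq_sym (negPf ji).
by exists l => s; rewrite gE lE.
Qed.

Definition mi_of_ord N (a : {ffun 'I_n -> 'I_N}) : MI n :=
  [ffun i => nat_of_ord (a i)].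

(** Bounded exponents are presented as the image of a finite function type, so that products of sums
    over the coordinates expand by distributivity. *)
Definition box N : seq (MI n) := [seq mi_of_ord a | a : {ffun 'I_n -> 'I_N}].

Lemma mi_of_ord_inj N : injective (@mi_of_ord N).
Proof.
move=> a b /ffunP ab; apply/ffunP => i; apply: val_inj.
by have := ab i; rewrite !ffunE.
Qed.

Lemma box_uniq N : uniq (box N).
Proof. by rewrite map_inj_uniq ?enum_uniq //; apply: mi_of_ord_inj. Qed.

Lemma mem_box N (a : MI n) : (a \in box N) = [forall i, a i < N]%N.
Proof.
apply/imageP/forallP => [[b _ ->] i|aN]; first by rewrite ffunE.
exists [ffun i => Ordinal (aN i)] => //; apply/ffunP => i; by rewrite !ffunE.
Qed.

Lemma polyfun_box f : polyfun f -> exists N (T : MI n -> V),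
  (forall a, a \notin box N -> T a = 0) /\
  forall s, f s = \sum_(a <- box N) tcoef C s a *: T a.
Proof.
move=> [l fl].
have [N lN] : exists N, forall p, p \in l -> p.1 \in box N.
  elim: l {fl} => [|p l [N IH]]; first by exists 0%N.
  exists (maxn N (\max_i p.1 i).+1) => q; rewrite in_cons mem_box.
  move=> /predU1P[->|/IH]; last first.
    by rewrite mem_box => /forallP qN; apply/forallP => i; rewrite leq_max qN.
  by apply/forallP => i; rewrite leq_max ltnS leq_bigmax orbT.
exists N, (fun a => (mifact a)%:R *: \sum_(p <- l | p.1 == a) p.2); split.
  move=> a aN; rewrite big_seq_cond big1 ?scaler0 // => p /andP[/lN pN /eqP pa].
  by rewrite -pa pN in aN.
move=> s; rewrite fl.
have tE a : tcoef C s a * (mifact a)%:R = spow C s a.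
  by rewrite /tcoef divfK ?mifact_neq0.
under [RHS]eq_bigr do rewrite scalerA tE scaler_sumr.
rewrite (exchange_big_dep xpredT) //=; apply: eq_big_seq => p /lN pN.
rewrite big_mkcond (bigD1_seq p.1) ?box_uniq //= eqxx big1 ?addr0 // => a.
by rewrite eq_sym => /negPf ->.
Qed.

End PolyFun.

(** On the line through s in direction i, [jetlaw] with first vector a eps_i is the relation of
    [differences_vanish] in End U, [dl] recording whether i = k. The operator is the bracket with
    D_i(-eps_i) for every s, so N is uniform. *)
Lemma jet_polyfun (C : numClosedFieldType) n (U : vectType C)
    (D : 'I_n -> Zn n -> 'End(U)) : jetlaw D -> forall k, polyfun (D k).
Proof.
move=> law k; apply: polyfun_of_differences => i.
pose e (a : int) : Zn n := upd 0 i a.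
have adlin a : linear (fun X : 'End(U) => (D i (e a) \o X)%VF - (X \o D i (e a))%VF).
  move=> c X Y; apply/lfunP => u.
  by rewrite !(add_lfunE, opp_lfunE, scale_lfunE, comp_lfunE); module_eq.
have [N NP] := differences_vanish (mk_linear (adlin (-1))).
exists N => s c.
apply: (NP (i == k) (fun a => mk_linear (adlin a)) (fun a => D i (e a))) => //.
move=> a x; apply/lfunP => u; rewrite !(add_lfunE, opp_lfunE, scale_lfunE, comp_lfunE).
have := law i k (e a) (upd s i x) u; rewrite !ffunE eqxx => E.
have ea : e a + upd s i x = upd s i (a + x).
  by apply/ffunP => l; rewrite !ffunE; case: eqP; rewrite ?add0r.
rewrite E ea eq_sym; case: eqP => [->|_]; first by rewrite mulr1.
by rewrite mulr0 !scale0r.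
Qed.

(** * Taylor coefficients *)

Section Taylor.
Variables (C : numClosedFieldType) (n : nat).

Lemma tcoefE (s : Zn n) (a : MI n) :
  tcoef C s a = \prod_i ((s i)%:~R ^+ a i / (a i)`!%:R).
Proof.
rewrite /tcoef /spow /mifact big_split /=; congr (_ * _).
by rewrite natr_prod prodfV.
Qed.

(** The binomial theorem with divided powers. The condition u + v = c is an indicator, so that the
    ranges do not depend on c and the product over coordinates can be distributed. *)
Lemma exp_fact_add N c (x y : C) : (c < N)%N ->
  (x + y) ^+ c / c`!%:R = \sum_(u < N) \sum_(v < N)
     (x ^+ u / u`!%:R) * (y ^+ v / v`!%:R) * (u + v == c)%N%:R.
Proof.
move=> cN; rewrite exchange_big /= exprDn mulr_suml.
pose F v := x ^+ (c - v) / (c - v)`!%:R * (y ^+ v / v`!%:R).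
transitivity (\sum_(v < c.+1) F v).
  apply: eq_bigr => -[v /= vc] _; rewrite ltnS in vc.
  have fN k : k`!%:R != 0 :> C by rewrite pnatr_eq0 -lt0n fact_gt0.
  rewrite /F -(bin_fact vc) !natrM -mulr_natr.
  by field; rewrite !fN pnatr_eq0 -lt0n bin_gt0 vc.
rewrite (big_ord_widen N F) // big_mkcond; apply: eq_bigr => v _.
case: ifP => vc; rewrite ltnS in vc.
  have uN : (c - v < N)%N by apply: leq_ltn_trans cN; apply: leq_subr.
  rewrite (bigD1 (Ordinal uN)) //= subnK // eqxx mulr1 big1 ?addr0 // => u uc.
  case: eqP => [uvc|_]; last by rewrite mulr0.
  by case/eqP: uc; apply: val_inj; rewrite /= -uvc addnK.
rewrite big1 // => u _; case: eqP => [uvc|_]; last by rewrite mulr0.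
by rewrite -uvc leq_addl in vc.
Qed.

(** Coefficient form of exp((s + m) z) = exp(s z) exp(m z). *)
Lemma tcoef_add N (s m : Zn n) (c : MI n) : c \in box n N ->
  tcoef C (s + m) c = \sum_(a <- box n N) \sum_(b <- box n N)
    tcoef C s a * tcoef C m b * (miadd a b == c)%:R.
Proof.
rewrite mem_box => /forallP cN; rewrite tcoefE.
transitivity (\prod_i \sum_(u < N) \sum_(v < N)
     ((s i)%:~R ^+ u / u`!%:R) * ((m i)%:~R ^+ v / v`!%:R) * (u + v == c i)%N%:R : C).
  by apply: eq_bigr => i _; rewrite -exp_fact_add // ffunE rmorphD.
rewrite bigA_distr_bigA /= big_image /=; apply: eq_bigr => a _.
rewrite bigA_distr_bigA /= big_image /=; apply: eq_bigr => b _.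
rewrite big_split big_split /= !tcoefE; congr (_ * _ * _).
- by apply: eq_bigr => i _; rewrite ffunE.
- by apply: eq_bigr => i _; rewrite ffunE.
case: eqP => [<-|abc].
  by rewrite big1 // => i _; rewrite !ffunE eqxx.
have [i ci] : exists i, (a i + b i)%N <> c i.
  apply: contra_notP abc => nex; apply/ffunP => i; rewrite !ffunE.
  by apply: contrapT => ?; apply: nex; exists i.
by apply/eqP/prodf_eq0; exists i; rewrite // (introF eqP ci).
Qed.

Lemma tcoef0 (a : MI n) : tcoef C 0 a = (a == mi0 n)%:R.
Proof.
rewrite tcoefE; case: eqP => [->|a0].
  by rewrite big1 // => i _; rewrite !ffunE expr0 fact0 divr1.
have [i ai] : exists i, a i <> 0%N.
  apply: contra_notP a0 => nex; apply/ffunP => i; rewrite !ffunE.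
  by apply: contrapT => ?; apply: nex; exists i.
apply/eqP/prodf_eq0; exists i => //; rewrite ffunE; move: ai; case: (a i) => // k _.
by rewrite exprS mul0r mul0r.
Qed.

Lemma tcoef_mi0 (s : Zn n) : tcoef C s (mi0 n) = 1.
Proof. by rewrite tcoefE big1 // => i _; rewrite !ffunE expr0 fact0 divr1. Qed.

Definition mieps (j : 'I_n) : MI n := [ffun i => nat_of_bool (i == j)].

(** Differentiating exp(s z) in z_j multiplies it by s_j. This is the origin of the factors beta_j
    and the exponents alpha + beta - eps_j in the bracket of W_n^+. *)
Lemma tcoef_eps (s : Zn n) (b : MI n) j :
  tcoef C s (miadd b (mieps j)) * (b j).+1%:R = (s j)%:~R * tcoef C s b.
Proof.
rewrite !tcoefE (bigD1 j) //= [in RHS](bigD1 j) //= !ffunE eqxx addn1.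
have fN k : k`!%:R != 0 :> C by rewrite pnatr_eq0 -lt0n fact_gt0.
rewrite mulrAC mulrA; congr (_ * _); last first.
  by apply: eq_bigr => i /negPf ij; rewrite !ffunE ij addn0.
have E (x p f k : C) : k != 0 -> f != 0 -> x * p / (k * f) * k = x * (p / f).
  by move=> k0 f0; field; rewrite k0 f0.
by rewrite factS natrM exprS E // pnatr_eq0.
Qed.

Definition box1 N := [seq a <- box n N | a != mi0 n].

Lemma box1_uniq N : uniq (box1 N).
Proof. by rewrite filter_uniq // box_uniq. Qed.

Variables (V : vectType C) (N : nat) (T : MI n -> V).
Hypothesis TN : forall a, a \notin box n N -> T a = 0.
Definition jetsum s := \sum_(a <- box n N) tcoef C s a *: T a.

Lemma jetsum_add s m : jetsum (s + m) = \sum_(a <- box n N) \sum_(b <- box n N)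
  (tcoef C s a * tcoef C m b) *: T (miadd a b).
Proof.
rewrite /jetsum; transitivity (\sum_(c <- box n N) \sum_(a <- box n N)
    \sum_(b <- box n N) (tcoef C s a * tcoef C m b * (miadd a b == c)%:R) *: T c).
  apply: eq_big_seq => c cN; rewrite (tcoef_add _ _ cN) scaler_suml.
  by apply: eq_bigr => a _; rewrite scaler_suml.
rewrite exchange_big; apply: eq_bigr => a _; rewrite exchange_big.
apply: eq_bigr => b _ /=.
have [abN|abN] := boolP (miadd a b \in box n N).
  rewrite (bigD1_seq (miadd a b)) ?box_uniq //= eqxx mulr1 big1 ?addr0 // => c.
  by rewrite eq_sym => /negPf ->; rewrite mulr0 scale0r.
rewrite (TN abN) scaler0 big_seq big1 // => c cN.
by case: eqP => [abc|_]; [rewrite abc cN in abN|rewrite mulr0 scale0r].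
Qed.

(** In the expansion [jetsum_add] the exponent b is replaced by b + eps_j through [tcoef_eps]. The
    shifted exponents may leave the box of size N, hence [N.+1]; each added term has b_j = 0 or
    vanishes by [out]. *)
Lemma jetsum_mul (j : 'I_n) (s m : Zn n) : (m j)%:~R *: jetsum (s + m) =
  \sum_(a <- box n N.+1) \sum_(b <- box n N.+1)
    (tcoef C s a * tcoef C m b) *: ((b j)%:R *: T (misubeps (miadd a b) j)).
Proof.
have boxS (a : MI n) : a \in box n N -> a \in box n N.+1.
  by rewrite !mem_box => /forallP aN; apply/forallP => i; rewrite leqW.
have subeps (a b : MI n) : misubeps (miadd a (miadd b (mieps j))) j = miadd a b.
  by apply/ffunP => i; rewrite !ffunE addnA addnK.
have epssub (b : MI n) : (0 < b j)%N -> miadd (misubeps b j) (mieps j) = b.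
  move=> bj; apply/ffunP => i; rewrite !ffunE; case: eqP => [->|_].
    by rewrite subnK.
  by rewrite subn0 addn0.
have epsI : injective (fun b => miadd b (mieps j)).
  by move=> b b' /ffunP bb'; apply/ffunP => i; have := bb' i; rewrite !ffunE => /addIn.
have out (a b : MI n) : (0 < b j)%N -> (a \notin box n N) || (misubeps b j \notin box n N) ->
    T (misubeps (miadd a b) j) = 0.
  move=> bj abN; apply: TN; move: abN; rewrite -negb_and; apply: contra.
  rewrite !mem_box => /forallP abN.
  apply/andP; split; apply/forallP => i; apply: leq_ltn_trans (abN i); rewrite !ffunE.
    by case: eqP => [->|_]; lia.
  by case: eqP => [->|_]; lia.
rewrite jetsum_add scaler_sumr.
transitivity (\sum_(a <- box n N) \sum_(b <- box n N.+1)
    (tcoef C s a * tcoef C m b) *: ((b j)%:R *: T (misubeps (miadd a b) j))).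
  apply: eq_bigr => a _; rewrite scaler_sumr.
  transitivity (\sum_(b <- [seq miadd b (mieps j) | b <- box n N])
      (tcoef C s a * tcoef C m b) *: ((b j)%:R *: T (misubeps (miadd a b) j))).
    rewrite [RHS]big_map; apply: eq_bigr => b _; rewrite subeps !scalerA.
    rewrite ffunE {2}/mieps ffunE eqxx addn1 -[in RHS]mulrA tcoef_eps.
    by congr (_ *: _); ring.
  apply: eq_sum_supp => [||b /mapP[b' b'N ->]|b bN bj]; rewrite ?box_uniq //.
  - by rewrite map_inj_uniq // box_uniq.
  - rewrite mem_box => /forallP[] i; move: b'N; rewrite mem_box => /forallP /(_ i).
    by rewrite !ffunE; case: eqP; lia.
  - have [b0|b0] := posnP (b j); first by rewrite b0 scale0r scaler0.
    rewrite out ?scaler0 //; apply/orP; right; apply: contra bj => bj.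
    by apply/mapP; exists (misubeps b j) => //; rewrite epssub.
apply: eq_sum_supp; rewrite ?box_uniq // => a.
  by move=> /boxS ->.
move=> _ aN; apply: big1 => b _.
have [b0|b0] := posnP (b j); first by rewrite b0 scale0r scaler0.
by rewrite out ?aN // !scaler0.
Qed.

(** The subtracted value is [jetsum (0 + m)], the part with a = 0, and terms with b = 0 carry the
    factor b_j = 0; only nonzero exponents remain, as in W_n^+. *)
Lemma jetsum_term (j : 'I_n) (s m : Zn n) : (m j)%:~R *: (jetsum (s + m) - jetsum m) =
  \sum_(a <- box1 N.+1) \sum_(b <- box1 N.+1)
    (tcoef C s a * tcoef C m b) *: ((b j)%:R *: T (misubeps (miadd a b) j)).
Proof.
rewrite scalerBr -[in jetsum m](add0r m) !jetsum_mul -sumrB /box1 big_filter.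
rewrite [RHS]big_mkcond; apply: eq_bigr => a _.
rewrite -sumrB; case: eqP => [->|/eqP a0] /=.
  by rewrite big1 // => b _; rewrite !tcoef_mi0 subrr.
rewrite big_filter [RHS]big_mkcond; apply: eq_bigr => b _ /=.
rewrite tcoef0 (negPf a0) mul0r scale0r subr0.
by case: eqP => // ->; rewrite ffunE scale0r scaler0.
Qed.

End Taylor.

(** The subtraction in [misubeps] is truncated only at a coordinate where the exponent, hence also
    the scalar in front, is 0. *)
Definition coeflaw (C : fieldType) n (U : vectType C) (T : 'I_n -> MI n -> 'End(U)) :=
  forall j k (a b : MI n) v, a <> mi0 n -> b <> mi0 n ->
    T j a (T k b v) - T k b (T j a v)
    = (b j)%:R *: T k (misubeps (miadd a b) j) v
      - (a k)%:R *: T j (misubeps (miadd a b) k) v.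

Lemma miaddC n (a b : MI n) : miadd a b = miadd b a.
Proof. by apply/ffunP => i; rewrite !ffunE addnC. Qed.

Lemma box_mono n N N' (a : MI n) : (N <= N')%N -> a \in box n N -> a \in box n N'.
Proof.
rewrite !mem_box => NN' /forallP aN; apply/forallP => i; exact: leq_trans NN'.
Qed.

Lemma box_bound n (A : seq (MI n)) : exists N, forall a, a \in A -> a \in box n N.
Proof.
elim: A => [|a A [N IH]]; first by exists 0%N.
exists (maxn N (\max_i a i).+1) => b; rewrite in_cons => /predU1P[->|/IH bN].
  by rewrite mem_box; apply/forallP => i; rewrite leq_max ltnS leq_bigmax orbT.
by apply: box_mono bN; rewrite leq_maxl.
Qed.

Lemma jetsum_widen (C : numClosedFieldType) n (V : vectType C) N N' (T : MI n -> V) s :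
  (N <= N')%N -> (forall a, a \notin box n N -> T a = 0) -> jetsum N' T s = jetsum N T s.
Proof.
move=> NN' TN; apply: eq_sum_supp; rewrite ?box_uniq // => a.
  by move=> _ /TN ->; rewrite scaler0.
by move=> /(box_mono NN') ->.
Qed.

Section CoefLaw.
Variables (C : numClosedFieldType) (n : nat) (U : vectType C).
Variables (T : 'I_n -> MI n -> 'End(U)).
Hypothesis T0 : forall j, T j (mi0 n) = 0.

Lemma jetsumE N j s : (forall a, a \notin box n N -> T j a = 0) ->
  jetsum N (T j) s = \sum_(a <- box1 n N) tcoef C s a *: T j a.
Proof.
move=> TN; apply: eq_sum_supp; rewrite ?box_uniq ?box1_uniq //.
  move=> a aN; rewrite mem_filter aN andbT negbK => /eqP ->.
  by rewrite T0 scaler0.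
by move=> a; rewrite mem_filter => /andP[_ ->].
Qed.

(** The defect of [jetlaw] is the generating function in s and m of the defects of [coeflaw];
    uniqueness of coefficients therefore makes the two laws equivalent. *)
Lemma jet_defect N j k s m v : (forall j a, a \notin box n N -> T j a = 0) ->
  jetsum N (T j) s (jetsum N (T k) m v) - jetsum N (T k) m (jetsum N (T j) s v)
  - ((m j)%:~R *: (jetsum N (T k) (s + m) v - jetsum N (T k) m v)
     - (s k)%:~R *: (jetsum N (T j) (s + m) v - jetsum N (T j) s v))
  = \sum_(a <- box1 n N.+1) tcoef C s a *: (\sum_(b <- box1 n N.+1) tcoef C m b *:
      (T j a (T k b v) - T k b (T j a v)
       - ((b j)%:R *: T k (misubeps (miadd a b) j) v
          - (a k)%:R *: T j (misubeps (miadd a b) k) v))).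
Proof.
move=> TN.
have TNS l a : a \notin box n N.+1 -> T l a = 0.
  by move=> aN; apply: TN; apply: contra aN; apply: box_mono.
have jE l t : jetsum N (T l) t = \sum_(a <- box1 n N.+1) tcoef C t a *: T l a.
  rewrite -jetsumE; last exact: TNS.
  by rewrite (@jetsum_widen _ _ _ N N.+1) //; apply: TN.
have app (A : seq (MI n)) (F : MI n -> 'End(U)) u :
    (\sum_(a <- A) F a) u = \sum_(a <- A) F a u.
  by rewrite sum_lfunE.
pose S (F : MI n -> MI n -> U) := \sum_(a <- box1 n N.+1) \sum_(b <- box1 n N.+1)
  (tcoef C s a * tcoef C m b) *: F a b.
have SB F G : S F - S G = S (fun a b => F a b - G a b).
  rewrite /S -sumrB; apply: eq_bigr => a _; rewrite -sumrB.
  by apply: eq_bigr => b _; rewrite scalerBr.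
transitivity (S (fun a b => T j a (T k b v)) - S (fun a b => T k b (T j a v))
  - (S (fun a b => (b j)%:R *: T k (misubeps (miadd a b) j) v)
     - S (fun a b => (a k)%:R *: T j (misubeps (miadd a b) k) v))); last first.
  rewrite !SB; apply: eq_bigr => a _; rewrite scaler_sumr.
  by apply: eq_bigr => b _; rewrite scalerA.
congr (_ - _ - (_ - _)).
- rewrite !jE !app; apply: eq_bigr => a _; rewrite scale_lfunE linear_sum scaler_sumr.
  by apply: eq_bigr => b _; rewrite scale_lfunE linearZ scalerA.
- rewrite !jE !app /S exchange_big; apply: eq_bigr => b _ /=.
  rewrite scale_lfunE linear_sum scaler_sumr.
  by apply: eq_bigr => a _; rewrite scale_lfunE linearZ scalerA mulrC.
- have := jetsum_term (TN k) j s m => /(congr1 (fun X : 'End(U) => X v)).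
  rewrite scale_lfunE !(add_lfunE, opp_lfunE) => ->; rewrite app.
  by apply: eq_bigr => a _; rewrite app; apply: eq_bigr => b _; rewrite !scale_lfunE.
- have := jetsum_term (TN j) k m s => /(congr1 (fun X : 'End(U) => X v)).
  rewrite scale_lfunE !(add_lfunE, opp_lfunE) [m + s]addrC => ->; rewrite app.
  rewrite /S [RHS]exchange_big.
  apply: eq_bigr => a _; rewrite app; apply: eq_bigr => b _ /=.
  by rewrite !scale_lfunE miaddC mulrC.
Qed.

Lemma coeflaw_jetlaw N : (forall j a, a \notin box n N -> T j a = 0) ->
  coeflaw T -> jetlaw (fun j => jetsum N (T j)).
Proof.
move=> TN law j k s m v; apply/eqP; rewrite -subr_eq0 jet_defect //; apply/eqP.
rewrite big_seq big1 // => a; rewrite mem_filter => /andP[/eqP a0 _].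
rewrite big_seq big1 ?scaler0 // => b; rewrite mem_filter => /andP[/eqP b0 _].
by rewrite law // subrr scaler0.
Qed.

Lemma jetlaw_coeflaw N : (forall j a, a \notin box n N -> T j a = 0) ->
  jetlaw (fun j => jetsum N (T j)) -> coeflaw T.
Proof.
move=> TN law j k a b v a0 b0.
(* The given exponents may lie outside the box of size N; the box is enlarged to contain them. *)
have [N1 N1P] := box_bound [:: a; b].
pose N' := maxn N N1.
have TN' l c : c \notin box n N' -> T l c = 0.
  by move=> cN; apply: TN; apply: contra cN; apply/box_mono/leq_maxl.
have abN c : c \in [:: a; b] -> c <> mi0 n -> c \in box1 n N'.+1.
  move=> /N1P cN /eqP c0; rewrite mem_filter c0 /=; apply: box_mono cN.
  by rewrite leqW // leq_maxr.
have wd l t : jetsum N (T l) t = jetsum N' (T l) t.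
  by rewrite (@jetsum_widen _ _ _ N N') ?leq_maxl //; apply: TN.
have bN := abN b; apply/eqP; rewrite -subr_eq0; apply/eqP.
pose F c d := T j c (T k d v) - T k d (T j c v)
       - ((d j)%:R *: T k (misubeps (miadd c d) j) v
          - (c k)%:R *: T j (misubeps (miadd c d) k) v).
have s0 := @subspace_eq0 C U.
apply: (@tcoef_coef C n U _ s0 _ (F a) (box1_uniq n N'.+1) _ b); last first.
  by apply: bN; rewrite ?inE ?eqxx ?orbT.
(* Coefficients are compared in s for each fixed m, and then in m. *)
move=> m; apply: (@tcoef_coef C n U _ s0 _
  (fun a => \sum_(d <- box1 n N'.+1) tcoef C m d *: F a d) (box1_uniq n N'.+1) _ a).
  by move=> s; rewrite -jet_defect // -!wd law subrr.
by apply: abN; rewrite ?inE ?eqxx.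
Qed.

Lemma Dinv_coef N (Q : U -> Prop) : (forall j a, a \notin box n N -> T j a = 0) ->
  is_subspace Q ->
  Dinv (fun j => jetsum N (T j)) Q <-> (forall j a u, a <> mi0 n -> Q u -> Q (T j a u)).
Proof.
move=> TN sQ; split=> [DQ j a u a0 Qu|TQ j s u Qu]; last first.
  rewrite sum_lfunE; apply: (subspace_sum sQ) => a _.
  rewrite scale_lfunE; apply: (subspaceZ sQ).
  have [->|/eqP a0] := eqVneq a (mi0 n); last exact: TQ.
  by rewrite T0 zero_lfunE; apply: subspace0 sQ.
have [aN|/TN ->] := boolP (a \in box n N); last by rewrite zero_lfunE; apply: subspace0 sQ.
apply: (tcoef_coef sQ (A := box n N) (v := fun a => T j a u)) => //.
  exact: box_uniq.
move=> s; have := DQ j s u Qu; rewrite sum_lfunE; congr Q.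
by apply: eq_bigr => b _; rewrite scale_lfunE.
Qed.

(** * The grading by the Euler field *)

Definition mideg (a : MI n) := (\sum_i a i)%N.

Lemma mideg_gt0 a : a <> mi0 n -> (0 < mideg a)%N.
Proof.
move=> a0; rewrite lt0n; apply: contra_notN a0 => /eqP da.
apply/ffunP => i; rewrite ffunE; apply/eqP; rewrite -leqn0 -da.
by rewrite /mideg (bigD1 i) //= leq_addr.
Qed.

Lemma mideg_sub (a b : MI n) j : (0 < b j)%N ->
  (mideg (misubeps (miadd a b) j)).+1 = (mideg a + mideg b)%N.
Proof.
move=> bj; rewrite /mideg -big_split /= (bigD1 j) //= [in RHS](bigD1 j) //=.
rewrite !ffunE eqxx -addSn; congr (_ + _)%N; first by lia.
by apply: eq_bigr => i /negPf ij; rewrite !ffunE ij subn0.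
Qed.

Lemma mieps_neq0 (j : 'I_n) : mieps j <> mi0 n.
Proof. by move=> /ffunP /(_ j); rewrite !ffunE eqxx. Qed.

Lemma epsK (b : MI n) j : misubeps (miadd (mieps j) b) j = b.
Proof. by apply/ffunP => i; rewrite !ffunE addKn. Qed.

Hypothesis law : coeflaw T.

Definition euler := \sum_i T i (mieps i).

(** The summand i contributes b_i and, for i = k, also -1: z^b d/dz_k is homogeneous of degree |b| -
    1. *)
Lemma euler_bracket k b v : b <> mi0 n ->
  euler (T k b v) - T k b (euler v) = ((mideg b)%:R - 1) *: T k b v.
Proof.
move=> b0; rewrite !sum_lfunE linear_sum -sumrB.
have L i := law i k v (@mieps_neq0 i) b0.
under eq_bigr do rewrite L epsK.
rewrite sumrB -scaler_suml -natr_sum scalerBl scale1r; congr (_ - _).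
rewrite (bigD1 k) //= ffunE eqxx scale1r epsK big1 ?addr0 // => i.
by rewrite ffunE eq_sym => /negPf ->; rewrite scale0r.
Qed.

(** The spectrum in question is that of the bracket with [euler] on End U, where a nonzero [T j b]
    is an eigenvector for |b| - 1; hence the shift -1. *)
Lemma coef_finite : exists N, forall j a, a \notin box n N -> T j a = 0.
Proof.
have adlin : linear (fun X : 'End(U) => (euler \o X)%VF - (X \o euler)%VF).
  move=> c X Y; apply/lfunP => u.
  by rewrite !(add_lfunE, opp_lfunE, scale_lfunE, comp_lfunE); module_eq.
have [rs rsP] := eigenvalues_finite (mk_linear adlin).
have [N NP] := shift_notin rs (-1); exists N.+1 => j b bN.
have [i bi] : exists i, (N < b i)%N.
  apply: contraNP bN => nb; rewrite mem_box; apply/forallP => i.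
  by rewrite ltnS leqNgt; apply: contra_notN nb => ?; exists i.
have b0 : b <> mi0 n by move=> b0; rewrite b0 ffunE in bi.
apply: contrapT => Tb.
suff bad : -1 + (mideg b)%:R \in rs.
  suff /NP : (N <= mideg b)%N by rewrite bad.
  by apply/ltnW/(leq_trans bi); rewrite /mideg (bigD1 i) //= leq_addr.
apply: rsP Tb; apply/lfunP => u /=.
rewrite !(add_lfunE, opp_lfunE, scale_lfunE, comp_lfunE).
by rewrite euler_bracket // addrC.
Qed.

(* An eigenvector of the Euler field z_1 d/dz_1 + ... + z_n d/dz_n with maximal
   eigenvalue is killed in degrees >= 2; the vectors killed in degrees >= 2 form
   a submodule. *)
Lemma irreducible_deg1 :
  irreducible (fun Q : U -> Prop => forall j a u, a <> mi0 n -> Q u -> Q (T j a u)) ->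
  forall j a, (1 < mideg a)%N -> T j a = 0.
Proof.
move=> [nz irr].
pose Q v := forall j a, (1 < mideg a)%N -> T j a v = 0.
have sQ : is_subspace Q.
  split=> [j a _|u v Qu Qv j a da|c u Qu j a da]; first by rewrite linear0.
    by rewrite linearD /= (Qu j a da) (Qv j a da) addr0.
  by rewrite linearZ /= (Qu j a da) scaler0.
(* For |b| >= 2 and |a| >= 1 the bracket has terms of degree |a| + |b| - 1 >= 2, which kill u. *)
have iQ j a u : a <> mi0 n -> Q u -> Q (T j a u).
  move=> a0 Qu k b db; have b0 : b <> mi0 n.
    by move=> b0; move: db; rewrite b0 /mideg big1 // => i _; rewrite ffunE.
  have := law k j u b0 a0; rewrite (Qu k b db) linear0 subr0 => ->.
  have da := mideg_gt0 a0.
  have kill l i (c d : MI n) : (2 < mideg c + mideg d)%N ->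
      (d i)%:R *: T l (misubeps (miadd c d) i) u = 0.
    move=> cd; have [->|di] := posnP (d i); first by rewrite scale0r.
    have dcd : (1 < mideg (misubeps (miadd c d) i))%N by rewrite -ltnS mideg_sub.
    by rewrite (Qu _ _ dcd) scaler0.
  have [ba ab] : (2 < mideg b + mideg a)%N /\ (2 < mideg a + mideg b)%N.
    by rewrite [(mideg a + _)%N]addnC (leq_add db da).
  by rewrite (kill j k b a ba) miaddC (kill k j a b ab) subrr.
have [Q0|Qall] := irr Q sQ iQ; last first.
  by move=> j a da; apply/lfunP => u; rewrite Qall // zero_lfunE.
exfalso; have [mu [x0 [Ex0 x00]]] := eigenvector_exists euler nz.
have [rs rsP] := eigenvalues_finite euler.
have [N NP] := shift_notin rs mu.
pose E k := `[< exists x, euler x = (mu + k%:R) *: x /\ x <> 0 >].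
have E0 : exists k, E k by exists 0%N; apply/asboolP; exists x0; rewrite addr0.
have EN k : E k -> (k <= N)%N.
  move=> /asboolP[x [Ex xN0]]; rewrite leqNgt; apply/negP => /ltnW /NP.
  by rewrite (rsP _ _ Ex xN0).
have [k /asboolP[x [Ex xN0]] kmax] := ex_maxnP E0 EN.
apply/xN0/Q0 => j a da; have a0 : a <> mi0 n.
  by move=> a0; move: da; rewrite a0 /mideg big1 // => i _; rewrite ffunE.
(* A nonzero [T j a x] is an eigenvector for mu + k + |a| - 1, beyond the maximum because |a| >=
   2. *)
apply: contrapT => Tax; suff /kmax : E (k + (mideg a).-1)%N by lia.
apply/asboolP; exists (T j a x); split=> //.
have /eqP := euler_bracket j x a0; rewrite subr_eq Ex => /eqP ->.
rewrite linearZ -scalerDl; congr (_ *: _).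
by rewrite natrD -[in LHS](ltn_predK da) -natr1; ring.
Qed.

End CoefLaw.

(** * Existence of the modules *)

Section FinSupp.
Variables (C : fieldType) (K : eqType) (U : lmodType C).

Definition fin_supp : {pred (K -> U)} :=
  fun f => `[< exists S : seq K, forall m, m \notin S -> f m = 0 >].

Lemma fin_supp_closed : submod_closed fin_supp.
Proof.
split=> [|a f g /asboolP[S fS] /asboolP[S' gS]]; apply/asboolP.
  by exists [::].
exists (S ++ S') => m; rewrite mem_cat negb_or => /andP[mS mS'].
by change (a *: f m + g m = 0); rewrite fS // gS // scaler0 addr0.
Qed.

HB.instance Definition _ := GRing.isSubmodClosed.Build C (K -> U) fin_supp fin_supp_closed.

(** For K = Z^n this is the model of F(T^n) (x) U. *)
Record finfunc := FinFunc { finfunc_val :> K -> U; _ : finfunc_val \in fin_supp }.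

HB.instance Definition _ := [isSub for finfunc_val].
HB.instance Definition _ := [Choice of finfunc by <:].
HB.instance Definition _ := [SubChoice_isSubLmodule of finfunc by <:].

Lemma finfunc_ext (f g : finfunc) : (forall m, f m = g m) -> f = g.
Proof. by move=> fg; apply/val_inj/funext. Qed.

Definition delta_fun m v : K -> U := fun k => if k == m then v else 0.

Lemma delta_fun_supp m v : delta_fun m v \in fin_supp.
Proof.
apply/asboolP; exists [:: m] => k; rewrite inE /delta_fun => /negPf -> //.
Qed.

Definition delta_elt m v := FinFunc (delta_fun_supp m v).

Lemma delta_elt_linear m : linear (delta_elt m).
Proof.
move=> a x y; apply: finfunc_ext => k.
change (delta_fun m (a *: x + y) k = a *: delta_fun m x k + delta_fun m y k).
by rewrite /delta_fun; case: ifP; rewrite // scaler0 addr0.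
Qed.

Lemma finfunc_decomp : decomp (fun _ _ => True) (fun m => mk_linear (delta_elt_linear m)).
Proof.
have sumE (S : seq K) (v : K -> U) m : uniq S ->
    (\sum_(k <- S) mk_linear (delta_elt_linear k) (v k) : finfunc) m
    = if m \in S then v m else 0.
  move=> uS; transitivity (\sum_(k <- S) delta_fun k (v k) m).
    elim/big_rec2: _ => // k y1 y2 _ <-; reflexivity.
  rewrite /delta_fun; case: ifP => mS.
    rewrite (bigD1_seq m) //= eqxx big1 ?addr0 // => k.
    by rewrite eq_sym => /negPf ->.
  by rewrite big_seq big1 // => k kS; case: eqP => // mk; rewrite mk kS in mS.
split=> [k|f|S v uS _ vS m mS]; first by split.
  have := valP f => /asboolP[S fS]; exists (undup S), f; split=> //.
  apply: finfunc_ext => m; rewrite sumE ?undup_uniq // mem_undup.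
  by case: ifPn => // /fS.
have := sumE S v m uS; rewrite vS mS => <- //.
Qed.

End FinSupp.

Lemma coords_exists (C : fieldType) n (U : vectType C) (lam : 'I_n -> C)
    (D : 'I_n -> Zn n -> 'End(U)) : (forall j, D j 0 = 0) ->
  exists M : WFmod C n, exists iota : Zn n -> {linear U -> wf_car M}, coords lam iota D.
Proof.
move=> D0; pose F : lmodType C := finfunc (Zn n) U.
pose io m : {linear U -> F} := mk_linear (@delta_elt_linear C (Zn n) U m).
have dec : decomp (fun _ _ => True) io := @finfunc_decomp C (Zn n) U.
have dE j s : exists f : {linear F -> F}, forall m v,
    f (io m v) = io (m + s) (((m j)%:~R + lam j) *: v + D j s v).
  have [f fE] := decomp_lift dec (fun m : Zn n => [the {linear U -> F} of
    io (m + s) \o (((((m j)%:~R + lam j) \*: (idfun : U -> U)) \+ D j s) : U -> U)]).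
  by exists f => m v; rewrite fE.
have eE k : exists f : {linear F -> F}, forall m v, f (io m v) = io (m + k) v.
  by have [f fE] := decomp_lift dec (fun m => io (m + k)); exists f => m v; rewrite fE.
pose M := @Build_WFmod C n F (fun j s => sval (cid (dE j s))) (fun k => sval (cid (eE k))).
exists M, (io : Zn n -> {linear U -> wf_car M}); case: (dec) => _ span indep; split=> //.
- split=> [x|]; first by have [S [v [_ ->]]] := span x; exists S, v.
  split=> [S v uS|k m w]; first exact: indep.
  by rewrite znE; apply: (svalP (cid (eE k))).
- by move=> j s m v; apply: (svalP (cid (dE j s))).
Qed.

(** * Representations of W_n^+ and gl_n *)

Section WP.
Variables (C : numClosedFieldType) (n : nat).

(** As z^0 d/dz_j is not in W_n^+, [wp_rho] is arbitrary at [mi0]. The value 0 lets the generating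
    function run over a full box and vanish at s = 0. *)
Definition wpT (U : WPmod C n) j a : 'End(wp_car U) :=
  if a == mi0 n then 0 else linfun (wp_rho U j a).

Lemma wpT0 U j : wpT U j (mi0 n) = 0.
Proof. by rewrite /wpT eqxx. Qed.

Lemma wpTE U j a v : a <> mi0 n -> wpT U j a v = wp_rho U j a v.
Proof. by move=> /eqP/negPf a0; rewrite /wpT a0 lfunE. Qed.

Lemma misubeps_neq0 (a b : MI n) j : a <> mi0 n -> (0 < b j)%N ->
  misubeps (miadd a b) j <> mi0 n.
Proof.
move=> a0 bj E; have := mideg_sub a bj; have := mideg_gt0 a0.
have := mideg_gt0 (n := n) (a := b); rewrite E.
have -> : mideg (mi0 n) = 0%N by rewrite /mideg big1 // => i _; rewrite ffunE.
have b0 : b <> mi0 n by move=> b0; rewrite b0 ffunE in bj.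
by move=> /(_ b0); lia.
Qed.

(** A bracket term with nonzero scalar has an exponent of degree |a| + |b| - 1 >= 1, so the value
    chosen at [mi0] does not interfere. *)
Lemma WPrep_coeflaw U : is_WPrep U <-> coeflaw (wpT U).
Proof.
have E l i (c d : MI n) v : c <> mi0 n ->
    (d i)%:R *: wp_rho U l (misubeps (miadd c d) i) v
    = (d i)%:R *: wpT U l (misubeps (miadd c d) i) v.
  move=> c0; have [->|di] := posnP (d i); first by rewrite !scale0r.
  by rewrite wpTE //; apply: misubeps_neq0.
split=> law j k a b v a0 b0; have := law j k a b v a0 b0.
  by rewrite (E k j a b) // (miaddC a b) (E j k b a) // !(wpTE _ _ a0, wpTE _ _ b0).
by rewrite -(E k j a b) // (miaddC a b) -(E j k b a) // !(wpTE _ _ a0, wpTE _ _ b0).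
Qed.

Lemma wpT_supp U B : supp_list U B ->
  exists N, forall j a, a \notin box n N -> wpT U j a = 0.
Proof.
move=> [uB B0 BU]; have [N NB] := box_bound B; exists N => j a aN.
rewrite /wpT; case: eqP => // a0; apply/lfunP => v; rewrite lfunE zero_lfunE /=.
by apply: BU => //; apply: contra aN; apply: NB.
Qed.

Lemma jetsum_supp U B N j s v : supp_list U B ->
  (forall j a, a \notin box n N -> wpT U j a = 0) ->
  jetsum N (wpT U j) s v = \sum_(b <- B) tcoef C s b *: wp_rho U j b v.
Proof.
move=> [uB B0 BU] TN; rewrite sum_lfunE.
rewrite (eq_bigr (fun a => tcoef C s a *: wpT U j a v)); last first.
  by move=> a _; rewrite scale_lfunE.
rewrite (@eq_sum_supp _ _ _ B) ?box_uniq // => [|a|a aB aN].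
- apply: eq_big_seq => b bB; rewrite wpTE // => b0.
  by move: B0; rewrite -b0 bB.
- move=> aN aB; have [->|/eqP a0] := eqVneq a (mi0 n).
    by rewrite wpT0 zero_lfunE scaler0.
  by rewrite wpTE // BU ?scaler0.
- by rewrite TN // zero_lfunE scaler0.
Qed.

Lemma jetsum0 (V : vectType C) N (T : MI n -> V) : T (mi0 n) = 0 -> jetsum N T 0 = 0.
Proof.
move=> T0; rewrite /jetsum big1 // => a _; rewrite tcoef0.
by case: eqP => [->|_]; rewrite ?T0 ?scaler0 ?scale0r.
Qed.

Lemma realizes_WP_coords M lam U : realizes_WP M lam U <->
  exists N, (forall j a, a \notin box n N -> wpT U j a = 0) /\
  exists iota : Zn n -> {linear wp_car U -> wf_car M},
    coords lam iota (fun j => jetsum N (wpT U j)).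
Proof.
split=> [[iota [dec [B [sB dE]]]]|[N [TN [iota [dec _ dE]]]]].
  have [N TN] := wpT_supp sB; exists N; split=> //; exists iota; split=> // [j|j s m v].
    by rewrite jetsum0 ?wpT0.
  rewrite dE (jetsum_supp _ _ _ sB) // linearD linearZ linear_sum !zaddE; congr (_ + _).
  by apply: eq_bigr => b _; rewrite linearZ.
exists iota; split=> //; exists (box1 n N).
have sB : supp_list U (box1 n N).
  split; first exact: box1_uniq.
    by rewrite mem_filter eqxx.
  move=> j b /[dup] /eqP b0 b0' bN v; rewrite -wpTE // TN ?zero_lfunE //.
  by move: bN; rewrite mem_filter b0.
split=> // j s m v.
rewrite dE (jetsum_supp _ _ _ sB) // linearD linearZ linear_sum !zaddE; congr (_ + _).
by apply: eq_bigr => b _; rewrite linearZ.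
Qed.

Lemma WP_indecomposable_Dinv U N : (forall j a, a \notin box n N -> wpT U j a = 0) ->
  WP_indecomposable U <-> indecomposable (Dinv (fun j => jetsum N (wpT U j))).
Proof.
move=> TN; apply: eq_indecomposable => Q sQ; rewrite (Dinv_coef (@wpT0 U) TN sQ).
split=> iQ j a u a0; first by rewrite wpTE //; apply: iQ.
by move=> Qu; have := iQ j a u a0 Qu; rewrite wpTE.
Qed.

Lemma jetsum_intertwine (U U' : vectType C) N N' (T : 'I_n -> MI n -> 'End(U))
    (T' : 'I_n -> MI n -> 'End(U')) (g : {linear U -> U'}) :
  (forall j a, a \notin box n N -> T j a = 0) ->
  (forall j a, a \notin box n N' -> T' j a = 0) ->
  (forall j s u, g (jetsum N (T j) s u) = jetsum N' (T' j) s (g u)) <->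
  (forall j a u, g (T j a u) = T' j a (g u)).
Proof.
move=> TN TN'; pose K := maxn N N'.
have TK j a : a \notin box n K -> T j a = 0.
  by move=> aK; apply: TN; apply: contra aK; apply/box_mono/leq_maxl.
have TK' j a : a \notin box n K -> T' j a = 0.
  by move=> aK; apply: TN'; apply: contra aK; apply/box_mono/leq_maxr.
have E j s u : g (jetsum N (T j) s u) = \sum_(a <- box n K) tcoef C s a *: g (T j a u).
  rewrite -(@jetsum_widen _ _ _ N K) ?leq_maxl //; last exact: TN.
  rewrite sum_lfunE linear_sum; apply: eq_bigr => a _.
  by rewrite scale_lfunE linearZ.
have E' j s u : jetsum N' (T' j) s u = \sum_(a <- box n K) tcoef C s a *: T' j a u.
  rewrite -(@jetsum_widen _ _ _ N' K) ?leq_maxr //; last exact: TN'.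
  by rewrite sum_lfunE; apply: eq_bigr => a _; rewrite scale_lfunE.
split=> gT j a u; last first.
  by rewrite E E'; apply: eq_bigr => b _; rewrite gT.
have [aK|aK] := boolP (a \in box n K); last first.
  by rewrite TK // TK' // !zero_lfunE linear0.
apply/eqP; rewrite -subr_eq0; apply/eqP.
apply: (tcoef_coef (@subspace_eq0 C U') (v := fun a => g (T j a u) - T' j a (g u))
  (box_uniq n K) _ aK) => s.
have /eqP := gT j s u; rewrite E E' -subr_eq0 -sumrB => /eqP e; rewrite -[RHS]e.
by apply: eq_bigr => b _; rewrite scalerBr.
Qed.

Lemma WP_iso_jetsum U U' N N' :
  (forall j a, a \notin box n N -> wpT U j a = 0) ->
  (forall j a, a \notin box n N' -> wpT U' j a = 0) ->
  WP_iso U U' <-> exists g : {linear wp_car U -> wp_car U'}, bijective g /\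
    forall j s u, g (jetsum N (wpT U j) s u) = jetsum N' (wpT U' j) s (g u).
Proof.
move=> TN TN'; split=> -[g [gb gE]]; exists g; split=> //.
  apply/(jetsum_intertwine g TN TN') => j a u.
  have [->|/eqP a0] := eqVneq a (mi0 n); first by rewrite !wpT0 !zero_lfunE linear0.
  by rewrite !wpTE // gE.
move=> j a u a0; have /(jetsum_intertwine g TN TN') gE' := gE.
by have := gE' j a u; rewrite !wpTE.
Qed.

(** The operators D_j(s) of a module on which W_n^+ acts through its degree-one part, hence linear
    in s. *)
Definition glD (V : GLmod C n) j (s : Zn n) : 'End(gl_car V) :=
  \sum_p (s p)%:~R *: linfun (gl_E V p j).

Lemma glDE V j s v : glD V j s v = \sum_p (s p)%:~R *: gl_E V p j v.
Proof.
by rewrite sum_lfunE; apply: eq_bigr => p _; rewrite scale_lfunE lfunE.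
Qed.

Lemma glD0 V j : glD V j 0 = 0.
Proof. by apply/lfunP => v; rewrite glDE zero_lfunE big1 // => p _; rewrite ffunE scale0r. Qed.

Definition zeps (p : 'I_n) : Zn n := [ffun i => (i == p)%:Z].

Lemma glD_eps V j p v : glD V j (zeps p) v = gl_E V p j v.
Proof.
rewrite glDE (bigD1 p) //= ffunE eqxx scale1r big1 ?addr0 // => q /negPf qp.
by rewrite ffunE qp scale0r.
Qed.

Lemma realizes_GL_coords M lam V : realizes_GL M lam V <->
  exists iota : Zn n -> {linear gl_car V -> wf_car M}, coords lam iota (glD V).
Proof.
split=> [[iota [dec dE]]|[iota [dec _ dE]]]; exists iota; split=> //.
- exact: glD0.
- move=> j s m v; rewrite dE glDE linearD linearZ linear_sum !zaddE; congr (_ + _).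
  by apply: eq_bigr => b _; rewrite linearZ.
move=> j s m v; rewrite dE glDE linearD linearZ linear_sum !zaddE; congr (_ + _).
by apply: eq_bigr => b _; rewrite linearZ.
Qed.

(** Additivity of [glD] in s reduces [jetlaw] to [D_j(s), D_k(m)] = m_j D_k(s) - s_k D_j(m),
    bilinear in s and m. *)
Lemma GLrep_jetlaw V : is_GLrep V -> jetlaw (glD V).
Proof.
move=> rep j k s m v.
have diff l (x y : Zn n) : glD V l (x + y) v - glD V l y v = glD V l x v.
  by rewrite !glDE -sumrB; apply: eq_bigr => p _; rewrite ffunE rmorphD scalerDl addrK.
rewrite diff (addrC s m) diff.
transitivity (\sum_p \sum_q ((s p)%:~R * (m q)%:~R) *:
    ((j == q)%:R *: gl_E V p k v - (k == p)%:R *: gl_E V q j v)).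
  rewrite [X in X - _]glDE [X in _ - X]glDE.
  under eq_bigr do rewrite glDE linear_sum scaler_sumr.
  under [X in _ - X]eq_bigr do rewrite glDE linear_sum scaler_sumr.
  rewrite [X in _ - X]exchange_big -sumrB; apply: eq_bigr => p _.
  rewrite -sumrB; apply: eq_bigr => q _; rewrite !linearZ /= !scalerA.
  by rewrite !scalerN -scalerBr mulrC rep.
transitivity (\sum_p \sum_q ((s p)%:~R * (m q)%:~R * (j == q)%:R) *: gl_E V p k v
  - \sum_p \sum_q ((s p)%:~R * (m q)%:~R * (k == p)%:R) *: gl_E V q j v).
  rewrite -sumrB; apply: eq_bigr => p _; rewrite -sumrB; apply: eq_bigr => q _.
  by rewrite scalerBr !scalerA.
rewrite !glDE !scaler_sumr; congr (_ - _).
  apply: eq_bigr => p _; rewrite (bigD1 j) //= eqxx mulr1 big1 ?addr0.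
    by rewrite scalerA mulrC.
  by move=> q /negPf; rewrite eq_sym => ->; rewrite mulr0 scale0r.
rewrite exchange_big; apply: eq_bigr => q _; rewrite (bigD1 k) //= eqxx mulr1 big1 ?addr0.
  by rewrite scalerA.
by move=> p /negPf; rewrite eq_sym => ->; rewrite mulr0 scale0r.
Qed.

Lemma GL_irreducible_Dinv V : GL_irreducible V <-> irreducible (Dinv (glD V)).
Proof.
apply: eq_irreducible => Q sQ; split=> iQ.
  move=> j s x Qx; rewrite glDE; apply: (subspace_sum sQ) => p _.
  by apply: (subspaceZ sQ); apply: iQ.
by move=> p q x Qx; rewrite -glD_eps; apply: iQ.
Qed.

Lemma GL_iso_glD V V' : GL_iso V V' <->
  exists g : {linear gl_car V -> gl_car V'}, bijective g /\
    forall j s u, g (glD V j s u) = glD V' j s (g u).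
Proof.
split=> -[g [gb gE]]; exists g; split=> //.
  move=> j s u; rewrite !glDE linear_sum; apply: eq_bigr => p _.
  by rewrite linearZ gE.
by move=> p q v; rewrite -!glD_eps gE.
Qed.

(* Degree-one part of W_n^+: z_p d/dz_q acts as the elementary matrix E^p_q. *)
Lemma deg1_glD (U : vectType C) N (T : 'I_n -> MI n -> 'End(U)) :
  (forall j, T j (mi0 n) = 0) -> (forall j a, a \notin box n N -> T j a = 0) ->
  coeflaw T -> (forall j a, (1 < mideg a)%N -> T j a = 0) ->
  let V := Build_GLmod (gl_car := U) (fun p q => T q (mieps p)) in
  is_GLrep V /\ forall j s, jetsum N (T j) s = glD V j s.
Proof.
move=> T0 TN law T2 V; split.
- move=> p q r t v /=; rewrite law; try exact: mieps_neq0.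
  have -> (w : U) : (mieps r q)%:R *: w = (q == r)%:R *: w by rewrite ffunE.
  have -> (w : U) : (mieps p t)%:R *: w = (t == p)%:R *: w by rewrite ffunE.
  congr (_ - _).
    case: eqP => [->|_]; last by rewrite !scale0r.
    by rewrite miaddC epsK.
  case: eqP => [->|_]; last by rewrite !scale0r.
  by rewrite epsK.
- move=> j s; have epsI : injective (@mieps n).
    move=> p q /ffunP /(_ p); rewrite !ffunE eqxx.
    by case: eqP.
  transitivity (\sum_(a <- [seq mieps p | p <- index_enum 'I_n]) tcoef C s a *: T j a).
    apply: eq_sum_supp => [||a aN aE|a _ aN].
    + exact: box_uniq.
    + by rewrite map_inj_uniq // index_enum_uniq.
    + have [->|/eqP a0] := eqVneq a (mi0 n); first by rewrite T0 scaler0.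
      have [da|/T2 ->] := leqP (mideg a) 1; last by rewrite scaler0.
      case/negP: aE; apply/mapP.
      have [i ai] : exists i, (0 < a i)%N.
        apply: contra_notP a0 => nex; apply/ffunP => i; rewrite ffunE.
        by apply/eqP; rewrite -leqn0 leqNgt; apply: contra_notN nex => ?; exists i.
      exists i; first by rewrite mem_index_enum.
      apply/ffunP => k; rewrite ffunE; move: da; rewrite /mideg (bigD1 i) //=.
      have [->|ki] := eqVneq k i.
        by move: ai; move: (a i) (\sum_(l < n | _) _)%N => /= x y; lia.
      rewrite (bigD1 k) //=; move: ai.
      by move: (a i) (a k) (\sum_(l < n | _) _)%N => /= x y z; lia.
    + by rewrite TN ?scaler0.
  rewrite big_map; apply: eq_bigr => p _; congr (_ *: _).
    rewrite tcoefE (bigD1 p) //= ffunE eqxx expr1 divr1 big1 ?mulr1 // => i /negPf ip.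
    by rewrite ffunE ip expr0 divr1.
  by apply/lfunP => v; rewrite lfunE.
Qed.

End WP.

(** * Category J *)

Section Weights.
Variables (C : numClosedFieldType) (n : nat) (M : WFmod C n).
Hypotheses (Mmod : is_WFmod M) (MJ1 : J1 M).
Let wt := {ffun 'I_n -> C}.
Let id_M : {linear wf_car M -> wf_car M} := idfun.

Lemma in_weight_subspace (mu : 'I_n -> C) : is_subspace (@in_weight C n M mu).
Proof.
split=> [j|x y xmu ymu j|a x xmu j].
- by rewrite /dj linear0 scaler0.
- by rewrite /dj linearD scalerDr -xmu -ymu.
- by rewrite /dj linearZ scalerA mulrC -scalerA -xmu.
Qed.

Lemma dj_comm j k x : dj M j (dj M k x) = dj M k (dj M j x).
Proof.
case: Mmod => rel _ _; have := rel j k (z0 n) (z0 n) x.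
by rewrite !ffunE !scale0r subrr => /eqP; rewrite subr_eq0 => /eqP.
Qed.

(** Simultaneous diagonalization, one d_l at a time; k counts the coordinates still to be treated.
    Because the d_j commute, [eigen_sum] keeps the pieces eigenvectors of the d_j already
    treated. *)
Lemma weight_span x :
  spanned (fun mu : wt => @in_weight C n M mu) (fun=> id_M) x.
Proof.
have subG (mu : wt) := in_weight_subspace mu.
suff H k y : (k <= n)%N -> (exists mu : wt, forall j : 'I_n, (j < n - k)%N -> dj M j y = mu j *: y) ->
    spanned (fun mu : wt => @in_weight C n M mu) (fun=> id_M) y.
  by apply: (H n) => //; exists 0 => j; rewrite subnn.
elim: k y => [|k IH] y kn [mu ymu].
  apply: (@spanned_mem _ _ _ _ _ (fun=> id_M) subG mu y) => j.
  by apply: ymu; rewrite subn0.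
have ln : (n - k.+1 < n)%N by lia.
pose l := Ordinal ln; have [S [z [yE zS]]] := MJ1 l y.
pose z' c := (count_mem c S)%:R *: z c.
have z'l c : c \in undup S -> dj M l (z' c) = c *: z' c.
  rewrite mem_undup => /zS zc.
  by rewrite /z' [LHS]linearZ /= zc !scalerA mulrC.
pose P w := forall j : 'I_n, (j < n - k.+1)%N -> dj M j w = mu j *: w.
have sP : is_subspace P.
  split=> [j _|u v Pu Pv j jk|a u Pu j jk].
  - by rewrite linear0 scaler0.
  - by rewrite linearD scalerDr Pu ?Pv.
  - by rewrite linearZ scalerA mulrC -scalerA Pu.
have Pz' c : c \in undup S -> P (z' c).
  apply: (eigen_sum (f := dj M l) (x := z') sP _ (undup_uniq S) z'l).
    by move=> u Pu j jk; rewrite dj_comm Pu // linearZ.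
  by rewrite -sum_undup -yE => j /ymu.
rewrite yE sum_undup; apply: (subspace_sum (spanned_subspace _ subG)) => c cS.
apply: IH (ltnW kn) _; exists [ffun j => if j == l then c else mu j] => j jk.
rewrite ffunE; case: eqP => [->|/eqP jl]; first exact: z'l.
apply: Pz' => //; have : (j != n - k.+1 :> nat)%N by [].
by move: jk; lia.
Qed.

Lemma weights_decomp : decomp (fun mu : wt => @in_weight C n M mu) (fun=> id_M).
Proof.
split=> [mu|x|S v uS Gv vS mu muS]; [exact: in_weight_subspace|exact: weight_span|].
apply: (joint_eigen_sum (T := dj M) (chi := fun (mu : wt) j => mu j) (P := fun x => x = 0)
  (x := v) _ (@subspace_eq0 C _) _ uS _ vS) => //.
- move=> nu nu' ne; have [j nj] : exists j, nu j != nu' j.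
    apply: contraNP ne => nex; apply/eqP/ffunP => j; apply/eqP.
    by apply: contra_notT nex => ?; exists j.
  by exists j.
- by move=> t x ->; rewrite linear0.
- by move=> nu j _; apply: Gv.
Qed.

Definition wshift (mu : 'I_n -> C) (s : Zn n) : wt := [ffun j => mu j + (s j)%:~R].

Lemma wshiftK mu s : wshift (wshift mu (- s)) s =1 mu.
Proof. by move=> j; rewrite !ffunE rmorphN /= subrK. Qed.

Lemma wshiftI s : injective (fun nu : wt => wshift nu s).
Proof. by move=> mu nu /ffunP st; apply/ffunP => j; have := st j; rewrite !ffunE => /addIr. Qed.

Lemma wshift_inj mu : injective (wshift mu).
Proof.
move=> s t /ffunP st; apply/ffunP => j; have := st j.
by rewrite !ffunE => /addrI /intr_inj.
Qed.

Lemma in_weight_d j s mu x : in_weight mu x -> in_weight (wshift mu s) (wf_d M j s x).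
Proof.
move=> xmu k; case: Mmod => rel _ _; have := rel k j (z0 n) s x.
rewrite -[wf_d M k (z0 n) x]/(dj M k x) xmu ![z0 n _]ffunE scale0r subr0 linearZ /=.
rewrite zaddE z0E add0r -z0E => /eqP; rewrite subr_eq => /eqP E.
by rewrite /dj E ffunE scalerDl addrC.
Qed.

Hypothesis MJ3 : J3 M.

Lemma in_weight_e m mu x : in_weight mu x -> in_weight (wshift mu m) (wf_e M m x).
Proof.
move=> xmu k; rewrite /dj MJ3 -[wf_d M k (z0 n) x]/(dj M k x) xmu linearZ /=.
by rewrite zaddE z0E addr0 ffunE scalerDl addrC.
Qed.

(** All d_j(s) and e_m shift weights by integer vectors, so the weight spaces of one class modulo
    Z^n span a submodule, complemented by those of the remaining classes. *)
Lemma indecomposable_weights : WF_indecomposable M ->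
  forall (lam mu : 'I_n -> C) (x y : wf_car M), in_weight lam x -> x <> 0 ->
  in_weight mu y -> y <> 0 -> same_class lam mu.
Proof.
move=> [_ nodec] lam mu x0 y0 lx0 x00 my0 y00; apply: contrapT => nclass; apply: nodec.
have decW := weights_decomp.
have exP (nu : wt) : exists f : {linear wf_car M -> wf_car M},
    forall (nu' : wt) (x : wf_car M), in_weight nu' x -> f x = if nu' == nu then x else 0.
  have [f fE] := decomp_lift decW (fun nu' : wt => if nu' == nu then id_M
    else [the {linear wf_car M -> wf_car M} of \0%R]).
  by exists f => nu' x /fE => /= ->; case: eqP.
pose pi nu := sval (cid (exP nu)).
have piE nu (nu' : wt) (x : wf_car M) : in_weight nu' x -> pi nu x = if nu' == nu then x else 0.
  exact: (svalP (cid (exP nu))).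
have pi_sum x : exists S : seq wt, x = \sum_(nu <- S) pi nu x.
  have [S [v [uS Gv vS xE]]] := decomp_uniq decW x; exists S.
  rewrite {1}xE; apply: eq_big_seq => nu nuS; rewrite xE linear_sum.
  rewrite (bigD1_seq nu) //= (piE nu nu) // eqxx big1 ?addr0 // => nu' /negPf ne.
  by rewrite (piE nu nu') // ne.
have pi_d (nu : wt) j s x : pi (wshift nu s) (wf_d M j s x) = wf_d M j s (pi nu x).
  suff fg : [the {linear _ -> _} of pi (wshift nu s) \o wf_d M j s]
    =1 [the {linear _ -> _} of wf_d M j s \o pi nu] by exact: fg.
  apply: (decomp_ext decW) => nu' y ny /=.
  rewrite (piE _ _ _ (in_weight_d j s ny)) (piE _ _ _ ny).
  rewrite (inj_eq (@wshiftI s)); case: eqP => // _; exact/esym/linear0.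
have pi_e (nu : wt) m x : pi (wshift nu m) (wf_e M m x) = wf_e M m (pi nu x).
  suff fg : [the {linear _ -> _} of pi (wshift nu m) \o wf_e M m]
    =1 [the {linear _ -> _} of wf_e M m \o pi nu] by exact: fg.
  apply: (decomp_ext decW) => nu' y ny /=.
  rewrite (piE _ _ _ (in_weight_e m ny)) (piE _ _ _ ny).
  rewrite (inj_eq (@wshiftI m)); case: eqP => // _; exact/esym/linear0.
have shiftE (nu : wt) s : nu = wshift (wshift nu (- s)) s.
  by apply/ffunP => j; rewrite wshiftK.
have class_shift nu s : same_class lam (wshift nu s) <-> same_class lam nu.
  split=> [[k kE]|[k kE]].
    by exists (k - s) => j; have := kE j; rewrite !ffunE rmorphB /= addrA => <-; rewrite addrK.
  by exists (k + s) => j; rewrite !ffunE rmorphD /= kE addrA.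
(* [P c] is the sum of the weight spaces outside c; thus the part belonging to the class of [lam] is
   [P (fun nu => ~ cl nu)]. *)
pose P (c : wt -> Prop) x := forall nu, c nu -> pi nu x = 0.
have sP c : is_subspace (P c).
  split=> [nu _|x y Px Py nu cn|a x Px nu cn]; first exact: linear0.
    by rewrite linearD Px ?Py ?addr0.
  by rewrite linearZ /= Px ?scaler0.
have iP c : (forall (nu : wt) s, c (wshift nu s) <-> c nu) -> WF_inv (P c).
  move=> cs; split=> [j s x Px nu|m x Px nu].
    rewrite (shiftE nu s) => /cs cn.
    by rewrite pi_d Px ?linear0.
  rewrite (shiftE nu m) => /cs cn.
  by rewrite pi_e Px ?linear0.
pose cl (nu : wt) := same_class lam nu.
have ffE (nu : 'I_n -> C) : exists nu' : wt, nu' =1 nu.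
  by exists [ffun j => nu j] => j; rewrite ffunE.
exists (P (fun nu => ~ cl nu)), (P cl); split; split=> //.
- by apply: iP => nu s; rewrite /cl class_shift.
- by apply: iP => nu s; apply: class_shift.
- have [lam' lamE] := ffE lam; exists x0; split=> // nu ncl.
  rewrite (piE nu lam') => [|j]; last by rewrite lamE.
  case: eqP => // lnu; case: ncl; exists 0 => j.
  by rewrite ffunE addr0 -lnu lamE.
- have [mu' muE] := ffE mu; exists y0; split=> // nu [k kE].
  rewrite (piE nu mu') => [|j]; last by rewrite muE.
  case: eqP => // mnu; case: nclass; exists k => j.
  by rewrite -muE mnu.
- move=> x Px Qx; have [S ->] := pi_sum x; rewrite big1 // => nu _.
  by have [/Qx|/Px] := pselect (cl nu).
- move=> x; have [S ->] := pi_sum x.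
  apply: (subspace_sum (add_subspace (sP _) (sP _))) => nu _.
  have nuw : in_weight nu (pi nu x).
    have [T [v [_ Gv _ xE]]] := decomp_uniq decW x.
    rewrite xE linear_sum; apply: (subspace_sum (in_weight_subspace nu)) => nu' _.
    rewrite (piE nu nu') //; case: eqP => [<-//|_].
    exact: subspace0 (in_weight_subspace nu).
  have [cn|ncn] := pselect (cl nu).
    exists (pi nu x), 0; split; rewrite ?addr0 //; last exact: subspace0 (sP _).
    move=> nu' ncn'; rewrite (piE _ _ _ nuw); case: eqP => // nn.
    by rewrite -nn in ncn'.
  exists 0, (pi nu x); split; rewrite ?add0r //; first exact: subspace0 (sP _).
  move=> nu' cn'; rewrite (piE _ _ _ nuw); case: eqP => // nn.
  by rewrite -nn in cn'.
Qed.

Lemma wshiftD mu s t : wshift (wshift mu s) t = wshift mu (s + t).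
Proof. by apply/ffunP => j; rewrite !ffunE rmorphD addrA. Qed.

Lemma wshift0 mu : wshift mu 0 =1 mu.
Proof. by move=> j; rewrite !ffunE addr0. Qed.

(** Replaces the decomposition over all weights by a grading by Z^n, on which e_m acts by
    translation. *)
Lemma class_decomp lam : WF_indecomposable M -> (exists x : wf_car M, x <> 0 /\ in_weight lam x) ->
  decomp (fun m : Zn n => @in_weight C n M (wshift lam m)) (fun=> id_M).
Proof.
move=> Mi [x0 [x00 lx0]].
have subG (m : Zn n) := in_weight_subspace (wshift lam m).
split=> // [x|S v uS Gv vS m mS].
  have [S [v [_ Gv _ ->]]] := decomp_uniq weights_decomp x.
  apply: (subspace_sum (spanned_subspace _ subG)) => mu _.
  have [->|/eqP v0] := eqVneq (v mu) 0; first exact: subspace0 (spanned_subspace _ subG).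
  have [k kE] := indecomposable_weights Mi lx0 x00 (Gv mu) v0.
  apply: (@spanned_mem _ _ _ _ _ (fun=> id_M) subG k) => j.
  by rewrite Gv kE ffunE.
apply: (joint_eigen_sum (T := dj M) (chi := fun (m : Zn n) j => wshift lam m j)
  (P := fun x => x = 0) (x := v) _ (@subspace_eq0 C _) _ uS _ vS) mS.
- move=> k k' ne; have [j kj] : exists j, wshift lam k j != wshift lam k' j.
    apply: contraNP ne => nex; apply/eqP/(@wshift_inj lam)/ffunP => j; apply/eqP.
    by apply: contra_notT nex => ?; exists j.
  by exists j.
- by move=> t x ->; rewrite linear0.
- by move=> k j _; apply: Gv.
Qed.

End Weights.

Section CategoryJ.
Variables (C : numClosedFieldType) (n : nat) (M : WFmod C n).
Hypotheses (MJ : in_catJ M) (Mi : WF_indecomposable M).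

Lemma wf_eD m k x : wf_e M m (wf_e M k x) = wf_e M (m + k) x.
Proof. by case: MJ => -[_ _ eM] _ _ _; rewrite eM zaddE. Qed.

Lemma wf_e0 x : wf_e M 0 x = x.
Proof. by case: MJ => -[_ e0 _] _ _ _; rewrite -{2}[x]e0 z0E. Qed.

Lemma weight_exists : exists lam : 'I_n -> C, exists x : wf_car M, x <> 0 /\ in_weight lam x.
Proof.
have [Mmod MJ1 _ _] := MJ; have [[x x0] _] := Mi.
have [S [v [_ Gv _ xE]]] := decomp_uniq (weights_decomp Mmod MJ1) x.
apply: contra_notP x0 => nex; rewrite xE big1 // => mu _ /=.
by apply: contra_notP nex => v0; exists mu, (v mu).
Qed.

(* J is free of rank r over F(T^n), with basis in C^r say; eps_lam moves every
   weight component to the weight lam by some e_k, and restricts to an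
   isomorphism from C^r onto the weight space of lam. *)
Lemma catJ_coords lam : (exists x : wf_car M, x <> 0 /\ in_weight lam x) ->
  exists r (iota : Zn n -> {linear 'rV[C]_r -> wf_car M}) (D : 'I_n -> Zn n -> 'End('rV[C]_r)),
    coords lam iota D.
Proof.
move=> lamx; have [Mmod MJ1 MJ2 MJ3] := MJ.
have decW := class_decomp Mmod MJ1 MJ3 Mi lamx.
have [r [iotaV decV]] := J2_tensor Mmod MJ2.
have [eps epsE0] := decomp_lift decW (fun m => wf_e M (- m)).
have epsE m x : in_weight (wshift lam m) x -> eps x = wf_e M (- m) x by apply: epsE0.
(* [epsV] sets every e_m to 1: it projects M onto its fibre at the unit point, identified with C^r.
   [eps] realizes the same fibre as the weight space of [lam]. *)
have [epsV epsVE] := tensor_lift decV (fun=> [the {linear 'rV[C]_r -> 'rV[C]_r} of idfun]).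
have wt0 (x : wf_car M) : in_weight (wshift lam 0) x <-> in_weight lam x.
  by split=> xlam j; rewrite xlam wshift0.
have eps_wt x : in_weight lam (eps x).
  have [S [v [_ Gv _ ->]]] := decomp_uniq decW x; rewrite linear_sum.
  apply: (subspace_sum (@in_weight_subspace C n M lam)) => m _ /=.
  rewrite (epsE _ _ (Gv m)); apply/wt0.
  by have := in_weight_e MJ3 (- m) (Gv m); rewrite wshiftD subrr.
have epsVe m x : epsV (wf_e M m x) = epsV x.
  suff fg : [the {linear _ -> _} of epsV \o wf_e M m] =1 epsV by exact: fg.
  by apply: (tensor_ext decV) => k w /=; rewrite (tensor_e decV) !epsVE.
have epse m x : eps (wf_e M m x) = eps x.
  suff fg : [the {linear _ -> _} of eps \o wf_e M m] =1 eps by exact: fg.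
  apply: (decomp_ext decW) => k w wk /=.
  have := in_weight_e MJ3 m wk; rewrite wshiftD => /epsE /= ->.
  by rewrite (epsE _ _ wk) wf_eD opprD subrK.
have epsVeps x : epsV (eps x) = epsV x.
  suff fg : [the {linear _ -> _} of epsV \o eps] =1 epsV by exact: fg.
  by apply: (decomp_ext decW) => k w wk /=; rewrite (epsE _ _ wk) epsVe.
pose phi := [the {linear 'rV[C]_r -> wf_car M} of eps \o iotaV 0].
have eps_phi x : eps x = phi (epsV x).
  suff fg : eps =1 [the {linear _ -> _} of phi \o epsV] by exact: fg.
  apply: (tensor_ext decV) => m v /=; rewrite epsVE /=.
  have -> : iotaV m v = wf_e M m (iotaV 0 v) by rewrite (tensor_e decV) add0r.
  by rewrite epse.
have phiK v : epsV (phi v) = v by rewrite /= epsVeps epsVE.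
have phi_wt m x : in_weight (wshift lam m) x -> x = wf_e M m (phi (epsV x)).
  by move=> xm; rewrite -eps_phi (epsE _ _ xm) wf_eD subrr wf_e0.
have e_wt m v : in_weight (wshift lam m) (wf_e M m (phi v)).
  exact/(in_weight_e MJ3)/eps_wt.
pose iota m := [the {linear 'rV[C]_r -> wf_car M} of wf_e M m \o phi].
pose D j s : 'End('rV[C]_r) :=
  linfun [the {linear _ -> _} of epsV \o (wf_d M j s \o phi)] - lam j *: \1%VF.
have DE j s v : D j s v = epsV (wf_d M j s (phi v)) - lam j *: v.
  by rewrite /D add_lfunE opp_lfunE scale_lfunE id_lfunE lfunE.
exists r, iota, D; split.
- split=> [x|]; [|split=> [S v uS vS m mS|k m w]].
  + have [S [v [_ Gv _ ->]]] := decomp_uniq decW x.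
    by exists S, (fun m => epsV (v m)); apply: eq_bigr => m _; apply: phi_wt (Gv m).
  + have [_ _ /(_ S (fun m => wf_e M m (phi (v m))) uS (fun m => e_wt m (v m)) vS m mS)] := decW.
    by move=> /(congr1 epsV); rewrite epsVe phiK linear0.
  + by rewrite /= wf_eD zaddE addrC.
- move=> j; apply/lfunP => v; rewrite DE zero_lfunE.
  have := eps_wt (iotaV 0 v) j; rewrite /dj z0E => E.
  by rewrite [wf_d M j 0 (phi v)]E linearZ /= -/(phi v) phiK subrr.
- move=> j s m v; rewrite DE /= MJ3 zaddE.
  have := in_weight_d Mmod j s (eps_wt (iotaV 0 v)) => /phi_wt {1}->.
  rewrite wf_eD scalerDl addrACA subrr addr0.
  by rewrite !linearD !linearZ.
Qed.

End CategoryJ.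

Lemma jet_expansion (C : numClosedFieldType) n (U : vectType C)
    (D : 'I_n -> Zn n -> 'End(U)) : jetlaw D -> (forall j, D j 0 = 0) ->
  exists N (T : 'I_n -> MI n -> 'End(U)),
    [/\ (forall j a, a \notin box n N -> T j a = 0), (forall j, T j (mi0 n) = 0) &
        D = fun j => jetsum N (T j)].
Proof.
move=> law D0.
have ex j : exists NT : nat * (MI n -> 'End(U)),
    (forall a, a \notin box n NT.1 -> NT.2 a = 0) /\
    forall s, D j s = jetsum NT.1 NT.2 s.
  by have [N [T NTj]] := polyfun_box (jet_polyfun law j); exists (N, T).
pose NT j := sval (cid (ex j)).
have NTP j : (forall a, a \notin box n (NT j).1 -> (NT j).2 a = 0) /\
    forall s, D j s = jetsum (NT j).1 (NT j).2 s by exact: (svalP (cid (ex j))).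
pose N := (\max_j (NT j).1)%N; exists N, (fun j => (NT j).2).
have NN j : ((NT j).1 <= N)%N by apply: leq_bigmax.
have TN j a : a \notin box n N -> (NT j).2 a = 0.
  by move=> aN; apply: (NTP j).1; apply: contra aN; apply: box_mono.
have DE j s : D j s = jetsum N (NT j).2 s.
  by rewrite (NTP j).2; apply/esym/jetsum_widen => //; apply: (NTP j).1.
split=> // [j|]; last by apply: funext => j; apply: funext => s; apply: DE.
have [aN|/TN -> //] := boolP (mi0 n \in box n N).
have := D0 j; rewrite DE /jetsum (bigD1_seq (mi0 n)) ?box_uniq //= big1.
  by rewrite tcoef0 eqxx scale1r addr0.
by move=> a /negPf a0; rewrite tcoef0 a0 scale0r.
Qed.

(** At an index m with m_j nonzero, d_j forces the component of a [lam]-vector to vanish; so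
    [iota 0] identifies U with the weight space. *)
Lemma coords_weight (C : numClosedFieldType) n (M : WFmod C n) lam (U : vectType C)
    (iota : Zn n -> {linear U -> wf_car M}) (D : 'I_n -> Zn n -> 'End(U)) :
  coords lam iota D ->
  exists pr : {linear wf_car M -> U}, (forall v, pr (iota 0 v) = v) /\
    forall u, in_weight lam u <-> u = iota 0 (pr u).
Proof.
move=> crd; have [dec D0 _] := crd; have [pr [prE prS]] := tensor_proj dec.
exists (pr 0); split=> [v|u]; first by rewrite prE eqxx.
split=> [ulam|-> j]; last by rewrite (coords_dj crd) ffunE add0r.
apply/eqP; rewrite -subr_eq0; apply/eqP/(pr_eq0 prS) => m.
rewrite linearB prE; case: eqP => [<-|/eqP m0]; first by rewrite subrr.
have [j mj] : exists j, m j != 0.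
  apply: contraNP m0 => nex; apply/eqP/ffunP => j; rewrite ffunE; apply/esym/eqP.
  by apply: contra_notT nex => ?; exists j.
have /eqP := congr1 (pr m) (ulam j); rewrite /dj z0E (pr_d crd prE) subr0 D0.
rewrite zero_lfunE addr0 linearZ /= -subr_eq0 -scalerBl addrK scaler_eq0 intr_eq0.
by rewrite (negPf mj) subr0 => /eqP.
Qed.

(* C = R[i] with R : realType, i.e. the complex numbers. *)
Theorem theorem3 (R : realType) (n : nat) :
  (* (a) *)
  (forall M : WFmod R[i] n, in_catJ M -> WF_indecomposable M ->
   forall lam : 'I_n -> R[i], (exists x : wf_car M, x <> 0 /\ in_weight lam x) ->
   [/\ (exists (r : nat) (b : 'I_r -> wf_car M), (forall i, in_weight lam (b i)) /\
          forall u, in_weight lam u ->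
            exists c : 'I_r -> R[i], u = \sum_(i < r) c i *: b i),
       (forall j s (u : wf_car M), in_weight lam u -> in_weight lam (wf_e M (zopp s) (wf_d M j s u))) &
       exists (A : seq (MI n)) (D : 'I_n -> MI n -> wf_car M -> wf_car M),
         [/\ D_expansion lam A D,
             (forall j a u, in_weight lam u -> in_weight lam (D j a u)),
             (forall j a (c : R[i]) u v, in_weight lam u -> in_weight lam v ->
                 D j a (c *: u + v) = c *: D j a u + D j a v),
             (forall (A' : seq (MI n)) (D' : 'I_n -> MI n -> wf_car M -> wf_car M),
                 D_expansion lam A' D' ->
                 forall j a u, a <> mi0 n -> in_weight lam u ->
                   extD A D j a u = extD A' D' j a u) &
             (forall j k (a b : MI n) u, a <> mi0 n -> b <> mi0 n -> in_weight lam u ->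
                 extD A D j a (extD A D k b u) - extD A D k b (extD A D j a u)
                 = (b j)%:R *: extD A D k (misubeps (miadd a b) j) u
                   - (a k)%:R *: extD A D j (misubeps (miadd a b) k) u)]])
  /\
  (* (b) *)
  ((forall U : WPmod R[i] n, is_WPrep U ->
      forall j, exists B : seq (MI n),
        forall b, b <> mi0 n -> b \notin B -> forall v, wp_rho U j b v = 0)
   /\ (forall (lam : 'I_n -> R[i]) (U : WPmod R[i] n), is_WPrep U -> WP_indecomposable U ->
        (exists M : WFmod R[i] n, realizes_WP M lam U) /\
        (forall M : WFmod R[i] n, realizes_WP M lam U -> in_catJ M /\ WF_indecomposable M))
   /\ (forall M : WFmod R[i] n, in_catJ M -> WF_indecomposable M ->
        exists (lam : 'I_n -> R[i]) (U : WPmod R[i] n),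
          [/\ is_WPrep U, WP_indecomposable U & realizes_WP M lam U])
   /\ (forall (M M' : WFmod R[i] n) (lam lam' : 'I_n -> R[i]) (U U' : WPmod R[i] n),
        is_WPrep U -> WP_indecomposable U -> is_WPrep U' -> WP_indecomposable U' ->
        realizes_WP M lam U -> realizes_WP M' lam' U' ->
        (WF_iso M M' <-> same_class lam lam' /\ WP_iso U U')))
  /\
  (* (c) *)
  ((forall (lam : 'I_n -> R[i]) (V : GLmod R[i] n), is_GLrep V -> GL_irreducible V ->
        (exists M : WFmod R[i] n, realizes_GL M lam V) /\
        (forall M : WFmod R[i] n, realizes_GL M lam V -> in_catJ M /\ WF_irreducible M))
   /\ (forall M : WFmod R[i] n, in_catJ M -> WF_irreducible M ->
        exists (lam : 'I_n -> R[i]) (V : GLmod R[i] n),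
          [/\ is_GLrep V, GL_irreducible V & realizes_GL M lam V])
   /\ (forall (M M' : WFmod R[i] n) (lam lam' : 'I_n -> R[i]) (V V' : GLmod R[i] n),
        is_GLrep V -> GL_irreducible V -> is_GLrep V' -> GL_irreducible V' ->
        realizes_GL M lam V -> realizes_GL M' lam' V' ->
        (WF_iso M M' <-> same_class lam lam' /\ GL_iso V V'))).
Proof.
split; [|split].
- move=> M MJ Mi lam lamx.
  have [r [iota [D crd]]] := catJ_coords MJ Mi lamx.
  have [Mmod _ _ _] := MJ; have [dec D0 _] := crd.
  have law := coords_law crd Mmod.
  have [N [T [TN T0 DE]]] := jet_expansion law D0.
  have Tlaw : coeflaw T by apply: (jetlaw_coeflaw T0 TN); rewrite -DE.
  have [pr [prK prP]] := coords_weight crd.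
  have wt v : in_weight lam (iota 0 v) by apply/prP; rewrite prK.
  have dE j s u : in_weight lam u ->
      wf_e M (zopp s) (wf_d M j s u) = iota 0 (lam j *: pr u + D j s (pr u)).
    move=> /prP {1}->; rewrite (coords_d crd) (tensor_e dec) znE add0r subrr.
    by rewrite ffunE add0r.
  split.
  + exists r, (fun i => iota 0 (delta_mx 0 i)); split=> [i|u /prP ->]; first exact: wt.
    exists (fun i => pr u 0 i); rewrite {1}(row_sum_delta (pr u)) linear_sum.
    by apply: eq_bigr => i _; rewrite linearZ.
  + by move=> j s u ulam; rewrite dE.
  (* The coefficients act on C^r; they are transported to the weight space by [iota 0], and [pr]
     extends them to all of M. *)
  exists (box1 n N), (fun j a u => iota 0 (T j a (pr u))).
  have extE j a u : extD (box1 n N) (fun j a u => iota 0 (T j a (pr u))) j a u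
      = iota 0 (T j a (pr u)).
    rewrite /extD; case: ifPn => // aN; suff -> : T j a = 0.
      by rewrite zero_lfunE linear0.
    move: aN; rewrite mem_filter; have [->|a0] := eqVneq a (mi0 n); first by rewrite T0.
    exact: TN.
  have exp : D_expansion lam (box1 n N) (fun j a u => iota 0 (T j a (pr u))).
    split; [exact: box1_uniq|by rewrite mem_filter eqxx|].
    move=> j s u ulam; rewrite dE // DE linearD linearZ -(prP u).1 //; congr (_ + _).
    rewrite (jetsumE T0) //; last exact: TN.
    by rewrite sum_lfunE linear_sum; apply: eq_bigr => a _; rewrite scale_lfunE linearZ.
  split=> //.
  + by move=> j a c u v _ _; rewrite !linearP.
  + move=> A' D' exp' j a u _ ulam.
    have [uA _ eA] := exp; have [uA' _ eA'] := exp'.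
    have ext (B L : seq (MI n)) (F : 'I_n -> MI n -> wf_car M -> wf_car M) s :
        uniq B -> uniq L -> {subset B <= L} ->
        \sum_(a <- B) tcoef R[i] s a *: F j a u = \sum_(a <- L) tcoef R[i] s a *: extD B F j a u.
      move=> uB uL BL; transitivity (\sum_(a <- B) tcoef R[i] s a *: extD B F j a u).
        by apply: eq_big_seq => b bB; rewrite /extD bB.
      apply: eq_sum_supp => // b; first by move=> /BL ->.
      by move=> _ /negPf bB; rewrite /extD bB scaler0.
    (* Over a common list the two expansions can be compared coefficient by coefficient. *)
    pose L := undup (box1 n N ++ A').
    have [aL|] := boolP (a \in L); last first.
      by rewrite mem_undup mem_cat negb_or /extD => /andP[/negPf -> /negPf ->].
    apply/eqP; rewrite -subr_eq0; apply/eqP.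
    apply: (tcoef_coef (@subspace_eq0 _ (wf_car M)) (v := fun a =>
      extD (box1 n N) (fun j a u => iota 0 (T j a (pr u))) j a u - extD A' D' j a u)
      (undup_uniq _) _ aL) => s /=.
    under eq_bigr do rewrite scalerBr.
    have /eqP := eA j s u ulam; rewrite eA' // => /eqP /addrI E.
    rewrite sumrB -ext ?undup_uniq //; last by move=> b bA; rewrite mem_undup mem_cat bA.
    rewrite -ext ?undup_uniq ?E ?subrr //.
    by move=> b bA; rewrite mem_undup mem_cat bA orbT.
  + move=> j k a b u a0 b0 ulam; rewrite !extE !prK -linearB Tlaw //.
    by rewrite linearB !linearZ.
- split; [|split; [|split]].
  + move=> U /WPrep_coeflaw law j.
    have [N TN] := coef_finite law; exists (box n N) => b b0 bN v.
    by rewrite -wpTE // TN // zero_lfunE.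
  + move=> lam U /WPrep_coeflaw law Ui; have [N TN] := coef_finite law; split.
      have [j|M [iota crd]] := coords_exists lam (D := fun j => jetsum N (wpT U j)).
        by rewrite jetsum0 ?wpT0.
      by exists M; apply/realizes_WP_coords; exists N; split=> //; exists iota.
    move=> M /realizes_WP_coords[N' [TN' [iota crd]]]; split.
      exact: (coords_catJ crd (coeflaw_jetlaw (@wpT0 _ _ U) TN' law)).
    exact/(coords_indecomposable crd)/(WP_indecomposable_Dinv TN').
  + move=> M MJ Mi; have [lam lamx] := weight_exists MJ Mi.
    have [r [iota [D crd]]] := catJ_coords MJ Mi lamx.
    have [Mmod _ _ _] := MJ; have [_ D0 _] := crd.
    have law := coords_law crd Mmod.
    have [N [T [TN T0 DE]]] := jet_expansion law D0.
    have Tlaw : coeflaw T by apply: (jetlaw_coeflaw T0 TN); rewrite -DE.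
    (* As [T] vanishes at [mi0], [wpT] returns [T] itself. *)
    pose U := Build_WPmod (wp_car := 'rV[R[i]]_r) (fun j a => T j a).
    have UT : wpT U = T.
      apply: funext => j; apply: funext => a; rewrite /wpT; case: eqP => [->|_ //].
        by rewrite T0.
      by apply/lfunP => v; rewrite lfunE.
    exists lam, U; split.
    * by apply/WPrep_coeflaw; rewrite UT.
    * apply/(@WP_indecomposable_Dinv _ _ _ N); rewrite UT // -DE.
      exact/(coords_indecomposable crd).
    * by apply/realizes_WP_coords; exists N; rewrite UT; split=> //; exists iota; rewrite -DE.
  + move=> M M' lam lam' U U' _ [nz _] _ _.
    move=> /realizes_WP_coords[N [TN [iota crd]]] /realizes_WP_coords[N' [TN' [iota' crd']]].
    by rewrite (coords_iso crd crd' nz) (WP_iso_jetsum TN TN').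
- split; [|split].
  + move=> lam V Vrep Virr; split.
      have [j|M [iota crd]] := coords_exists lam (D := glD V); first exact: glD0.
      by exists M; apply/realizes_GL_coords; exists iota.
    move=> M /realizes_GL_coords[iota crd]; split.
      exact/(coords_catJ crd)/GLrep_jetlaw.
    exact/(coords_irreducible crd)/GL_irreducible_Dinv.
  + move=> M MJ Mirr; have Mi : WF_indecomposable M := irreducible_indecomposable Mirr.
    have [lam lamx] := weight_exists MJ Mi.
    have [r [iota [D crd]]] := catJ_coords MJ Mi lamx.
    have [Mmod _ _ _] := MJ; have [_ D0 _] := crd.
    have law := coords_law crd Mmod.
    have [N [T [TN T0 DE]]] := jet_expansion law D0.
    have Tlaw : coeflaw T by apply: (jetlaw_coeflaw T0 TN); rewrite -DE.
    have Dirr : irreducible (Dinv D) by apply/(coords_irreducible crd).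
    have T2 : forall j a, (1 < mideg a)%N -> T j a = 0.
      (* Subspaces invariant under the D_j(s) are those invariant under the coefficients, so
         irreducibility passes to W_n^+. *)
      apply: (irreducible_deg1 Tlaw); move: Dirr; rewrite DE.
      by apply: (eq_irreducible _).1 => Q sQ; apply: Dinv_coef.
    have [Vrep VE] := deg1_glD T0 TN Tlaw T2; set V := Build_GLmod _ in Vrep VE.
    have DV : D = glD V.
      by rewrite DE; apply: funext => j; apply: funext => s; apply: VE.
    exists lam, V; split=> //.
      by apply/GL_irreducible_Dinv; rewrite -DV.
    by apply/realizes_GL_coords; exists iota; rewrite -DV.
  + move=> M M' lam lam' V V' _ [nz _] _ _ /realizes_GL_coords[iota crd].
    move=> /realizes_GL_coords[iota' crd'].
    by rewrite (coords_iso crd crd' nz) GL_iso_glD.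
Qed.
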